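(* Let $E$ and $F$ be row-finite directed graphs with no sources, and let $R$ be an integral domain with identity. The following are equivalent. (1) There is a ring $*$-isomorphism $\pi: L_R(E)\to L_R(F)$ such that $\pi(D(E))=D(F)$. (2) The topological groupoids $G_E$ and $G_F$ are isomorphic.
   Context: A directed graph $E=(E^0,E^1,r,s)$ consists of countable sets $E^0$ (vertices), $E^1$ (edges) and maps $r,s:E^1\to E^0$. It is row-finite if $r^{-1}(v)$ is finite for every $v\in E^0$, and has no sources if $r^{-1}(v)\neq\emptyset$ for every $v$. Paths are sequences of edges $\mu=\mu_1\mu_2\cdots$ with $s(\mu_i)=r(\mu_{i+1})$; $P(E)$ is the set of finite paths (vertices are paths of length $0$, with $r(v)=s(v)=v$), $|\mu|$ is the length of $\mu\in P(E)$, $r(\mu)=r(\mu_1)$, $s(\mu)=s(\mu_{|\mu|})$, and $E^\infty$ is the set of infinite paths. Graph groupoid: $G_E$ is the set of triples $(x,k,y)\in E^\infty\times\mathbb{Z}\times E^\infty$ such that there are $\mu,\nu\in P(E)$ and $z\in E^\infty$ with $x=\mu z$, $y=\nu z$, $k=|\mu|-|\nu|$; $r(x,k,y)=x$, $s(x,k,y)=y$, $(x,k,y)(y,l,z)=(x,k+l,z)$, $(x,k,y)^{-1}=(y,-k,x)$, and $x\in E^\infty$ is identified with the unit $(x,0,x)$. For $\mu,\nu\in P(E)$ with $s(\mu)=s(\nu)$ put $Z(\mu,\nu)=\{(\mu z,|\mu|-|\nu|,\nu z): z\in E^\infty, r(z)=s(\mu)\}$; these sets form a basis for the (Hausdorff)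 topology of $G_E$, and are compact. $Z(\mu)=\{\mu z\}$ is identified with $Z(\mu,\mu)$. Isomorphism of topological groupoids means a groupoid isomorphism that is a homeomorphism. The ring $R$ is commutative and has an involution $r\mapsto\overline r$ (a ring automorphism with $\overline{\overline r}=r$; complex conjugation if $R$ is a subring of $\mathbb{C}$), the same one being used for $E$ and $F$. Leavitt path algebra: $L_R(E)$ is the universal $R$-algebra generated by $\{p_v,s_e,s_{e^*}: v\in E^0,e\in E^1\}$ where the $p_v$ are mutually orthogonal idempotents, $p_{r(e)}s_e=s_e=s_ep_{s(e)}$, $p_{s(e)}s_{e^*}=s_{e^*}=s_{e^*}p_{r(e)}$, $s_{e^*}s_f=\delta_{e,f}p_{s(e)}$, and $p_v=\sum_{r(e)=v}s_es_{e^*}$. With $s_\mu=s_{\mu_1}\cdots s_{\mu_{|\mu|}}$ and $s_{\mu^*}=s_{\mu_{|\mu|}^*}\cdots s_{\mu_1^*}$ (and $s_v=s_{v^*}=p_v$), it is spanned over $R$ by the $s_\mu s_{\nu^*}$; its involution is $\sum r_{\mu,\nu}s_\mu s_{\nu^*}\mapsto\sum\overline{r_{\mu,\nu}}s_\nu s_{\mu^*}$, and its diagonal is $D(E)=\operatorname{span}_R\{s_\mu s_{\mu^*}:\mu\in P(E)\}$. The paper identifies $L_R(E)$ with the Steinberg algebra of $G_E$, i.e. the $R$-span of the characteristic functions $\mathbf 1_{Z(\mu,\nu)}:G_E\to R$ with convolution $f*g(\gamma)=\sum_{r(\eta)=r(\gamma)}f(\eta)g(\eta^{-1}\gamma)$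 and involution $f^*(\gamma)=\overline{f(\gamma^{-1})}$, via $s_\mu s_{\nu^*}\mapsto\mathbf 1_{Z(\mu,\nu)}$; then $D(E)=\operatorname{span}_R\{\mathbf 1_{Z(\mu)}\}$. A ring $*$-isomorphism is a ring isomorphism preserving the involutions (not assumed $R$-linear). *)

(* Defs.v *)
From HB Require Import structures.
From mathcomp Require Import all_boot all_order all_algebra.
From mathcomp Require Import mathcomp_extra boolp classical_sets functions.
From mathcomp Require Import cardinality filter topology.
From mathcomp Require Import zify.

Set Implicit Arguments.
Unset Strict Implicit.
Unset Printing Implicit Defensive.

Import GRing.Theory.
Local Open Scope classical_set_scope.
Local Open Scope ring_scope.
Local Open Scope quotient_scope.

Record digraph := Digraph {
  vert : countType;
  edge : countType;
  rng : edge -> vert;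
  src : edge -> vert }.

Definition row_finite (E : digraph) : Prop :=
  forall v : vert E, finite_set [set e : edge E | rng e = v].

Definition no_sources (E : digraph) : Prop :=
  forall v : vert E, [set e : edge E | rng e = v] !=set0.

Fixpoint is_path (E : digraph) (v : vert E) (l : seq (edge E)) : bool :=
  if l is e :: l' then (rng e == v) && is_path (src e) l' else true.

(* The range is recorded explicitly, so that vertices are the paths with an
   empty list of edges. *)
Record fpath (E : digraph) := FPath {
  prng : vert E;
  pedges : seq (edge E);
  pathP : is_path prng pedges }.

Definition psrc (E : digraph) (mu : fpath E) : vert E :=
  last (prng mu) (map (@src E) (pedges mu)).

Definition plen (E : digraph) (mu : fpath E) : nat := size (pedges mu).

Record ipath (E : digraph) := IPath {
  ipath_fun :> nat -> edge E;
  ipathP : forall i, src (ipath_fun i) = rng (ipath_fun i.+1) }.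

Definition irng (E : digraph) (x : ipath E) : vert E := rng (x 0%N).

(* [is_cat mu z x] : the concatenation [mu z] is defined and equal to [x]. *)
Definition is_cat (E : digraph) (mu : fpath E) (z x : ipath E) : Prop :=
  irng z = psrc mu /\
  forall i, x i = if (i < plen mu)%N then nth (z 0%N) (pedges mu) i
                  else z (i - plen mu)%N.

Section PathTheory.
Variable E : digraph.
Implicit Types (mu nu : fpath E) (x y z : ipath E).

Lemma fpath_ext mu nu : prng mu = prng nu -> pedges mu = pedges nu -> mu = nu.
Proof.
case: mu nu => [v l p] [w m q] /= ew el; subst w m.
by rewrite (bool_irrelevance p q).
Qed.

Lemma ipath_ext x y : (forall i, x i = y i) -> x = y.
Proof.
case: x y => [x p] [y q] /= /funext exy; subst y.
by rewrite (Prop_irrelevance p q).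
Qed.

Definition ipath_shift (n : nat) (x : ipath E) : ipath E :=
  @IPath E (fun i => x (n + i)%N)
    (fun i => etrans (ipathP x (n + i))
               (congr1 (fun j => rng (x j)) (esym (addnS n i)))).

Lemma is_path_mkseq x n m : is_path (rng (x m)) [seq x i | i <- iota m n].
Proof. by elim: n m => //= n IH m; rewrite eqxx ipathP IH. Qed.

Definition ipath_prefix (x : ipath E) (n : nat) : fpath E :=
  FPath (is_path_mkseq x n 0).

Lemma plen_prefix x n : plen (ipath_prefix x n) = n.
Proof. by rewrite /plen size_map size_iota. Qed.

Lemma nth_prefix x n e i : (i < n)%N -> nth e (pedges (ipath_prefix x n)) i = x i.
Proof. by move=> lin; rewrite (nth_map 0%N) ?size_iota // nth_iota. Qed.

Lemma psrc_prefix x n : psrc (ipath_prefix x n) = rng (x n).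
Proof.
rewrite /psrc /= -map_comp; case: n => [//|n].
by rewrite -[n.+1]addn1 iotaD map_cat last_cat /= addn1 ipathP.
Qed.

Lemma eq_prefix x y n :
  irng x = irng y -> (forall i, (i < n)%N -> x i = y i) ->
  ipath_prefix x n = ipath_prefix y n.
Proof.
move=> e h; apply: fpath_ext => //=.
by apply/eq_in_map => i; rewrite mem_iota => /andP[_]; rewrite add0n; apply: h.
Qed.

Lemma prefix_eq x y n i : (i < n)%N -> ipath_prefix x n = ipath_prefix y n -> x i = y i.
Proof.
by move=> lin e; rewrite -(nth_prefix x (x 0%N) lin) e nth_prefix.
Qed.

Lemma is_catP mu z x :
  is_cat mu z x <-> mu = ipath_prefix x (plen mu) /\ z = ipath_shift (plen mu) x.
Proof.
split=> [[e h]|[-> ->]]; last first.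
  rewrite plen_prefix; split; first by rewrite psrc_prefix /irng /= addn0.
  move=> i; rewrite plen_prefix; case: ltnP => hi; first by rewrite nth_prefix.
  by rewrite /= subnKC.
split; last first.
  by apply: ipath_ext => i /=; rewrite h ltnNge leq_addr /= addKn.
have hl : pedges mu = [seq x i | i <- iota 0 (plen mu)].
  apply: (@eq_from_nth _ (z 0%N)); first by rewrite size_map size_iota.
  move=> i hi; rewrite (nth_map 0%N) ?size_iota // nth_iota // add0n h.
  by rewrite /plen hi.
apply: fpath_ext => //=.
have := h 0%N; have := pathP mu; move: e; rewrite /psrc /plen.
case: (pedges mu) => [|a l] /=.
  by rewrite /irng => <- _ ->.
by rewrite /irng => _ /andP[/eqP <- _] ->.
Qed.

Lemma is_cat_prefix x n : is_cat (ipath_prefix x n) (ipath_shift n x) x.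
Proof. by apply/is_catP; rewrite plen_prefix. Qed.

End PathTheory.

(* Multiplication takes a proof of composability; its continuity is that of the
   restriction to the subspace of composable pairs. *)
Record topGroupoid := TopGroupoid {
  gobj : Type;
  garr : topologicalType;
  grng : garr -> gobj;
  gsrc : garr -> gobj;
  gunit : gobj -> garr;
  ginv : garr -> garr;
  gmul : forall g h : garr, gsrc g = grng h -> garr;
  grng_unit : forall a, grng (gunit a) = a;
  gsrc_unit : forall a, gsrc (gunit a) = a;
  grng_inv : forall g, grng (ginv g) = gsrc g;
  gsrc_inv : forall g, gsrc (ginv g) = grng g;
  grng_mul : forall g h (e : gsrc g = grng h), grng (gmul e) = grng g;
  gsrc_mul : forall g h (e : gsrc g = grng h), gsrc (gmul e) = gsrc h;
  gmul1g : forall g (e : gsrc (gunit (grng g)) = grng g), gmul e = g;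
  gmulg1 : forall g (e : gsrc g = grng (gunit (gsrc g))), gmul e = g;
  gmulVg : forall g (e : gsrc (ginv g) = grng g), gmul e = gunit (gsrc g);
  gmulgV : forall g (e : gsrc g = grng (ginv g)), gmul e = gunit (grng g);
  gmulA : forall f g h (e1 : gsrc f = grng g) (e2 : gsrc g = grng h)
    (e3 : gsrc (gmul e1) = grng h) (e4 : gsrc f = grng (gmul e2)),
    gmul e3 = gmul e4;
  ginv_continuous : continuous ginv;
  gmul_continuous : forall g h (e : gsrc g = grng h) (U : set garr),
    nbhs (gmul e) U ->
    exists V W : set garr, [/\ nbhs g V, nbhs h W &
      forall g' h' (e' : gsrc g' = grng h'), V g' -> W h' -> U (gmul e')] }.

Definition groupoid_hom (G H : topGroupoid) (phi : garr G -> garr H) : Prop :=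
  forall (g h : garr G) (e : gsrc g = grng h),
    exists e' : gsrc (phi g) = grng (phi h), phi (gmul e) = gmul e'.

Definition topGroupoid_isomorphic (G H : topGroupoid) : Prop :=
  exists (phi : garr G -> garr H) (psi : garr H -> garr G),
    [/\ cancel phi psi, cancel psi phi,
        groupoid_hom phi, groupoid_hom psi &
        continuous phi /\ continuous psi].

Record graph_arrow (E : digraph) := GraphArrow {
  arr_rng : ipath E;
  arr_deg : int;
  arr_src : ipath E;
  arrP : exists (mu nu : fpath E) (z : ipath E),
    [/\ is_cat mu z arr_rng, is_cat nu z arr_src &
        arr_deg = (plen mu)%:Z - (plen nu)%:Z] }.

HB.instance Definition _ (E : digraph) := gen_eqMixin (graph_arrow E).
HB.instance Definition _ (E : digraph) := gen_choiceMixin (graph_arrow E).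

Definition cylinder (E : digraph) (mu nu : fpath E) : set (graph_arrow E) :=
  [set g | exists z : ipath E,
    [/\ is_cat mu z (arr_rng g), is_cat nu z (arr_src g) &
        arr_deg g = (plen mu)%:Z - (plen nu)%:Z]].

Definition cylinders (E : digraph) : set_system (graph_arrow E) :=
  [set A | exists mu nu : fpath E, psrc mu = psrc nu /\ A = cylinder mu nu].

Section GraphGroupoid.
Variable E : digraph.
Implicit Types (mu nu : fpath E) (x y z : ipath E) (g h : graph_arrow E).

Lemma graph_arrow_ext g h :
  arr_rng g = arr_rng h -> arr_deg g = arr_deg h -> arr_src g = arr_src h ->
  g = h.
Proof.
case: g h => [x k y p] [x' k' y' p'] /= ex ek ey; subst x' k' y'.
by rewrite (Prop_irrelevance p p').
Qed.

Definition lag_eq (x : ipath E) (k : int) (y : ipath E) (m n : nat) : Prop :=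
  k = m%:Z - n%:Z /\ forall i, x (m + i)%N = y (n + i)%N.

Lemma lag_eqD x k y m n p : lag_eq x k y m n -> lag_eq x k y (m + p) (n + p).
Proof. by case=> -> h; split; [lia | move=> i; rewrite -!addnA h]. Qed.

Lemma lag_eq_widen x k y m n m' n' : lag_eq x k y m n -> (m <= m')%N ->
  k = m'%:Z - n'%:Z -> lag_eq x k y m' n'.
Proof.
move=> l lm e; have ek := l.1.
have -> : m' = (m + (m' - m))%N by lia.
have -> : n' = (n + (m' - m))%N by lia.
exact: lag_eqD.
Qed.

Lemma arr_okP x k y :
  (exists mu nu z, [/\ is_cat mu z x, is_cat nu z y &
     k = (plen mu)%:Z - (plen nu)%:Z]) <-> exists m n, lag_eq x k y m n.
Proof.
split=> [[mu [nu [z [/is_catP[_ ->] /is_catP[_ e] ek]]]]|[m [n [-> h]]]].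
  exists (plen mu), (plen nu); split=> // i.
  exact: (congr1 (fun t : ipath E => t i) e).
exists (ipath_prefix x m), (ipath_prefix y n), (ipath_shift m x); rewrite !plen_prefix.
split=> //; first exact: is_cat_prefix.
have -> : ipath_shift m x = ipath_shift n y by apply: ipath_ext => i /=; apply: h.
exact: is_cat_prefix.
Qed.

Lemma arr_lag g : exists m n, lag_eq (arr_rng g) (arr_deg g) (arr_src g) m n.
Proof. exact/arr_okP/arrP. Qed.

Lemma cylinderE mu nu g : cylinder mu nu g <->
  [/\ mu = ipath_prefix (arr_rng g) (plen mu), nu = ipath_prefix (arr_src g) (plen nu) &
      lag_eq (arr_rng g) (arr_deg g) (arr_src g) (plen mu) (plen nu)].
Proof.
split=> [[z [/is_catP[e1 ->] /is_catP[e2 e] ek]]|[e1 e2 [ek h]]].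
  by split=> //; split=> // i; exact: (congr1 (fun t : ipath E => t i) e).
exists (ipath_shift (plen mu) (arr_rng g)); split=> //; apply/is_catP; split=> //.
by apply: ipath_ext => i /=; apply: h.
Qed.

Lemma cylinder_prefix g m n :
  lag_eq (arr_rng g) (arr_deg g) (arr_src g) m n ->
  cylinders (cylinder (ipath_prefix (arr_rng g) m) (ipath_prefix (arr_src g) n)) /\
  cylinder (ipath_prefix (arr_rng g) m) (ipath_prefix (arr_src g) n) g.
Proof.
move=> l; split; last by apply/cylinderE; rewrite !plen_prefix.
exists (ipath_prefix (arr_rng g) m), (ipath_prefix (arr_src g) n); split=> //.
by rewrite !psrc_prefix; have := l.2 0%N; rewrite !addn0 => ->.
Qed.

Lemma cylinder_sub mu nu mu' nu' g :
  (plen mu <= plen mu')%N -> cylinder mu nu g -> cylinder mu' nu' g ->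
  cylinder mu' nu' `<=` cylinder mu nu.
Proof.
move=> lm /cylinderE[e1 e2 [ek hg]] /cylinderE[e1' e2' [ek' hg']] h.
move=> /cylinderE[f1 f2 [fk hh]].
have lmn : (plen mu' + plen nu = plen mu + plen nu')%N by lia.
have r i : (i < plen mu')%N -> arr_rng h i = arr_rng g i.
  by move=> hi; apply: (prefix_eq hi); rewrite -f1 -e1'.
have s i : (i < plen nu')%N -> arr_src h i = arr_src g i.
  by move=> hi; apply: (prefix_eq hi); rewrite -f2 -e2'.
apply/cylinderE; split.
- rewrite e1 plen_prefix; apply: eq_prefix => [|i hi].
    by have := congr1 (@prng E) (etrans (esym e1') f1).
  by rewrite r //; apply: leq_trans lm.
- rewrite e2 plen_prefix; apply: eq_prefix => [|i hi].
    by have := congr1 (@prng E) (etrans (esym e2') f2).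
  by rewrite s //; lia.
- split=> [|i]; first by lia.
  have [hi|hi] := ltnP (plen mu + i) (plen mu').
    by rewrite r // s; [exact: hg | lia].
  have := hh (plen mu + i - plen mu')%N.
  rewrite subnKC //; move=> ->; congr (arr_src h _); lia.
Qed.

Lemma cylinders_cover : \bigcup_(A in @cylinders E) id A = setT.
Proof.
apply/seteqP; split=> // g _.
have [m [n l]] := arr_lag g.
by have [c cg] := cylinder_prefix l; exists (cylinder (ipath_prefix (arr_rng g) m)
  (ipath_prefix (arr_src g) n)).
Qed.

Lemma cylinders_join (A B : set (graph_arrow E)) g :
  cylinders A -> cylinders B -> A g -> B g ->
  exists C, [/\ cylinders C, C g & C `<=` A `&` B].
Proof.
move=> cA cB Ag Bg.
have [mu [nu [_ eA]]] := cA; have [mu' [nu' [_ eB]]] := cB.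
subst A B; have [lm|/ltnW lm] := leqP (plen mu) (plen mu').
  exists (cylinder mu' nu'); split=> // h hh; split=> //.
  exact: (cylinder_sub lm Ag Bg).
exists (cylinder mu nu); split=> // h hh; split=> //.
exact: (cylinder_sub lm Bg Ag).
Qed.

End GraphGroupoid.

HB.instance Definition _ (E : digraph) :=
  @isBaseTopological.Build (graph_arrow E) (set (graph_arrow E))
    (@cylinders E) id (@cylinders_cover E) (@cylinders_join E).

Section GraphGroupoidOps.
Variable E : digraph.
Implicit Types (x y z : ipath E) (g h : graph_arrow E).

Lemma nbhs_cylinder g (U : set (graph_arrow E)) :
  nbhs g U <-> exists A, [/\ cylinders A, A g & A `<=` U].
Proof.
rewrite nbhsE; split=> [[B [oB Bg] sBU]|[A [cA Ag sAU]]].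
  move: oB Bg sBU; rewrite /open /= => -[D' sD' <-] [A D'A Ag] sBU.
  exists A; split=> //; first exact: sD'.
  by move=> h Ah; apply: sBU; exists A.
exists A => //; split=> //; exists [set A]; first by move=> _ ->.
by rewrite bigcup_set1.
Qed.

Lemma arr_mul_subproof g h : arr_src g = arr_rng h ->
  exists mu nu z, [/\ is_cat mu z (arr_rng g), is_cat nu z (arr_src h) &
    arr_deg g + arr_deg h = (plen mu)%:Z - (plen nu)%:Z].
Proof.
move=> e; apply/arr_okP.
have [m [n [eg hg]]] := arr_lag g; have [p [q [eh hh]]] := arr_lag h.
exists (m + p)%N, (n + q)%N; split; first by lia.
by move=> i; rewrite -addnA hg e addnCA hh addnCA addnA.
Qed.

Definition arr_mul g h (e : arr_src g = arr_rng h) : graph_arrow E :=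
  GraphArrow (arr_mul_subproof e).

Lemma arr_inv_subproof g :
  exists mu nu z, [/\ is_cat mu z (arr_src g), is_cat nu z (arr_rng g) &
    - arr_deg g = (plen mu)%:Z - (plen nu)%:Z].
Proof.
apply/arr_okP; have [m [n [-> h]]] := arr_lag g.
by exists n, m; split=> //; lia.
Qed.

Definition arr_inv g : graph_arrow E := GraphArrow (arr_inv_subproof g).

Lemma arr_unit_subproof x :
  exists mu nu z, [/\ is_cat mu z x, is_cat nu z x &
    0 = (plen mu)%:Z - (plen nu)%:Z].
Proof. by apply/arr_okP; exists 0%N, 0%N. Qed.

Definition arr_unit x : graph_arrow E := GraphArrow (arr_unit_subproof x).

Lemma arr_inv_continuous : continuous arr_inv.
Proof.
move=> g U /nbhs_cylinder[A [[mu [nu [emn ->]]] [z [a b c]] sAU]].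
apply/nbhs_cylinder; exists (cylinder nu mu); split.
- by exists nu, mu.
- by exists z; split=> //; move: c => /=; lia.
- move=> h [t [a' b' c']]; apply: sAU; exists t; split=> //.
  by move: c' => /=; lia.
Qed.

Lemma arr_mul_continuous g h (e : arr_src g = arr_rng h)
    (U : set (graph_arrow E)) :
  nbhs (arr_mul e) U ->
  exists V W : set (graph_arrow E), [/\ nbhs g V, nbhs h W &
    forall g' h' (e' : arr_src g' = arr_rng h'),
      V g' -> W h' -> U (arr_mul e')].
Proof.
move=> /nbhs_cylinder[A [[mu [nu [emn ->]]] /cylinderE[/= e1 e2 [ek hA]] sAU]].
have [m [n lg]] := arr_lag g; have [p [q lh]] := arr_lag h.
have [eg _] := lg; have [eh _] := lh.
pose b := (n + p + plen mu + absz (arr_deg g))%N.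
pose a := absz (b%:Z + arr_deg g); pose c := absz (b%:Z - arr_deg h).
have lga : lag_eq (arr_rng g) (arr_deg g) (arr_src g) a b.
  by apply: (lag_eq_widen lg); rewrite /a /b; lia.
have lhc : lag_eq (arr_rng h) (arr_deg h) (arr_src h) b c.
  by apply: (lag_eq_widen lh); rewrite /c /b; lia.
have [cV Vg] := cylinder_prefix lga; have [cW Wh] := cylinder_prefix lhc.
have ma : (plen mu <= a)%N by rewrite /a /b; lia.
have nc : (a + plen nu = plen mu + c)%N by have := lga.1; have := lhc.1; lia.
exists (cylinder (ipath_prefix (arr_rng g) a) (ipath_prefix (arr_src g) b)).
exists (cylinder (ipath_prefix (arr_rng h) b) (ipath_prefix (arr_src h) c)); split.
- by apply/nbhs_cylinder; eexists; split; [exact: cV | exact: Vg |].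
- by apply/nbhs_cylinder; eexists; split; [exact: cW | exact: Wh |].
move=> g' h' e' /cylinderE[]; rewrite !plen_prefix => f1 _ [fk1 fg].
move=> /cylinderE[]; rewrite !plen_prefix => _ f2 [fk2 fh].
apply: sAU.
have cAc : cylinder (ipath_prefix (arr_rng g) a) (ipath_prefix (arr_src h) c) (arr_mul e).
  apply/cylinderE; rewrite !plen_prefix /=; split=> //.
  split=> [|i]; first by have := lga.1; have := lhc.1; lia.
  by rewrite lga.2 e lhc.2.
have cAm : cylinder mu nu (arr_mul e) by apply/cylinderE.
apply: (cylinder_sub _ cAm cAc); first by rewrite plen_prefix.
apply/cylinderE; rewrite !plen_prefix /=; split=> //.
by split=> [|i]; [lia | rewrite fg e' fh].
Qed.

Lemma arr_mul1g g (e : arr_src (arr_unit (arr_rng g)) = arr_rng g) :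
  arr_mul e = g.
Proof. by apply: graph_arrow_ext => //=; rewrite add0r. Qed.

Lemma arr_mulg1 g (e : arr_src g = arr_rng (arr_unit (arr_src g))) :
  arr_mul e = g.
Proof. by apply: graph_arrow_ext => //=; rewrite addr0. Qed.

Lemma arr_mulVg g (e : arr_src (arr_inv g) = arr_rng g) :
  arr_mul e = arr_unit (arr_src g).
Proof. by apply: graph_arrow_ext => //=; rewrite addNr. Qed.

Lemma arr_mulgV g (e : arr_src g = arr_rng (arr_inv g)) :
  arr_mul e = arr_unit (arr_rng g).
Proof. by apply: graph_arrow_ext => //=; rewrite addrN. Qed.

Lemma arr_mulA f g h (e1 : arr_src f = arr_rng g) (e2 : arr_src g = arr_rng h)
    (e3 : arr_src (arr_mul e1) = arr_rng h)
    (e4 : arr_src f = arr_rng (arr_mul e2)) :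
  arr_mul e3 = arr_mul e4.
Proof. by apply: graph_arrow_ext => //=; rewrite addrA. Qed.

Definition graph_groupoid : topGroupoid :=
  @TopGroupoid (ipath E) (graph_arrow E) (@arr_rng E) (@arr_src E)
    arr_unit arr_inv arr_mul
    (fun=> erefl) (fun=> erefl) (fun=> erefl) (fun=> erefl)
    (fun _ _ _ => erefl) (fun _ _ _ => erefl)
    arr_mul1g arr_mulg1 arr_mulVg arr_mulgV arr_mulA
    arr_inv_continuous arr_mul_continuous.

End GraphGroupoidOps.

(* Algebras are associative but not necessarily unital: [L_R(E)] has no unit
   when [E] has infinitely many vertices. *)
Record algebra_law (R : comNzRingType) (A : lmodType R) (mul : A -> A -> A)
    : Prop := AlgebraLaw {
  alg_mulA : forall x y z, mul x (mul y z) = mul (mul x y) z;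
  alg_mulDl : forall x y z, mul (x + y) z = mul x z + mul y z;
  alg_mulDr : forall x y z, mul x (y + z) = mul x y + mul x z;
  alg_scalel : forall c x y, mul (c *: x) y = c *: mul x y;
  alg_scaler : forall c x y, mul x (c *: y) = c *: mul x y }.

(* In the last relation the list [l] enumerates the (finite) set of edges with
   range [v]. *)
Record leavitt_family (E : digraph) (R : comNzRingType) (A : lmodType R)
    (mul : A -> A -> A) (p : vert E -> A) (s t : edge E -> A)
    : Prop := LeavittFamily {
  lf_pp : forall v, mul (p v) (p v) = p v;
  lf_pq : forall v w, v != w -> mul (p v) (p w) = 0;
  lf_ps : forall e, mul (p (rng e)) (s e) = s e;
  lf_sp : forall e, mul (s e) (p (src e)) = s e;
  lf_pt : forall e, mul (p (src e)) (t e) = t e;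
  lf_tp : forall e, mul (t e) (p (rng e)) = t e;
  lf_ts : forall e f, mul (t e) (s f) = if e == f then p (src e) else 0;
  lf_ck : forall v (l : seq (edge E)), uniq l ->
    (forall e, (e \in l) = (rng e == v)) ->
    p v = \sum_(e <- l) mul (s e) (t e) }.

(* [L_R(E)] is constructed as the quotient of formal expressions by the least
   congruence containing the axioms of [R]-algebras and the defining
   relations. *)
Inductive lpa_term (E : digraph) (R : Type) : Type :=
  | Vert of vert E
  | Edge of edge E
  | Ghost of edge E
  | Zero
  | Add of lpa_term E R & lpa_term E R
  | Scale of R & lpa_term E R
  | Mul of lpa_term E R & lpa_term E R.

Arguments Vert {E R}.
Arguments Edge {E R}.
Arguments Ghost {E R}.
Arguments Zero {E R}.

HB.instance Definition _ E R := gen_eqMixin (lpa_term E R).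
HB.instance Definition _ E R := gen_choiceMixin (lpa_term E R).

Inductive lpa_eq (E : digraph) (R : comNzRingType)
    : lpa_term E R -> lpa_term E R -> Prop :=
  | rel_refl a : lpa_eq a a
  | rel_sym a b : lpa_eq a b -> lpa_eq b a
  | rel_trans a b c : lpa_eq a b -> lpa_eq b c -> lpa_eq a c
  | rel_add a a' b b' : lpa_eq a a' -> lpa_eq b b' ->
      lpa_eq (Add a b) (Add a' b')
  | rel_scale c a a' : lpa_eq a a' -> lpa_eq (Scale c a) (Scale c a')
  | rel_mul a a' b b' : lpa_eq a a' -> lpa_eq b b' ->
      lpa_eq (Mul a b) (Mul a' b')
  | rel_addA a b c : lpa_eq (Add a (Add b c)) (Add (Add a b) c)
  | rel_addC a b : lpa_eq (Add a b) (Add b a)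
  | rel_add0 a : lpa_eq (Add Zero a) a
  | rel_addN a : lpa_eq (Add (Scale (-1) a) a) Zero
  | rel_scaleA c d a : lpa_eq (Scale c (Scale d a)) (Scale (c * d) a)
  | rel_scale1 a : lpa_eq (Scale 1 a) a
  | rel_scaleDr c a b : lpa_eq (Scale c (Add a b)) (Add (Scale c a) (Scale c b))
  | rel_scaleDl a c d : lpa_eq (Scale (c + d) a) (Add (Scale c a) (Scale d a))
  | rel_mulA a b c : lpa_eq (Mul a (Mul b c)) (Mul (Mul a b) c)
  | rel_mulDl a b c : lpa_eq (Mul (Add a b) c) (Add (Mul a c) (Mul b c))
  | rel_mulDr a b c : lpa_eq (Mul a (Add b c)) (Add (Mul a b) (Mul a c))
  | rel_scalel c a b : lpa_eq (Mul (Scale c a) b) (Scale c (Mul a b))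
  | rel_scaler c a b : lpa_eq (Mul a (Scale c b)) (Scale c (Mul a b))
  | rel_pp v : lpa_eq (Mul (Vert v) (Vert v)) (Vert v)
  | rel_pq v w : v != w -> lpa_eq (Mul (Vert v) (Vert w)) Zero
  | rel_ps e : lpa_eq (Mul (Vert (rng e)) (Edge e)) (Edge e)
  | rel_sp e : lpa_eq (Mul (Edge e) (Vert (src e))) (Edge e)
  | rel_pt e : lpa_eq (Mul (Vert (src e)) (Ghost e)) (Ghost e)
  | rel_tp e : lpa_eq (Mul (Ghost e) (Vert (rng e))) (Ghost e)
  | rel_ts e f : lpa_eq (Mul (Ghost e) (Edge f))
      (if e == f then Vert (src e) else Zero)
  | rel_ck v (l : seq (edge E)) : uniq l ->
      (forall e, (e \in l) = (rng e == v)) ->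
      lpa_eq (Vert v)
        (foldr (fun e a => Add (Mul (Edge e) (Ghost e)) a) Zero l).

Section LeavittPathAlgebra.
Variables (E : digraph) (R : comNzRingType).
Implicit Types (a b : lpa_term E R).

Definition lpa_eqb a b : bool := `[< lpa_eq a b >].

Lemma lpa_eqb_refl : reflexive lpa_eqb.
Proof. by move=> a; apply/asboolP/rel_refl. Qed.

Lemma lpa_eqb_sym : symmetric lpa_eqb.
Proof. by move=> a b; apply/asboolP/asboolP => /rel_sym. Qed.

Lemma lpa_eqb_trans : transitive lpa_eqb.
Proof.
by move=> b a c /asboolP h1 /asboolP h2; apply/asboolP; apply: rel_trans h1 h2.
Qed.

Canonical lpa_equiv :=
  EquivRel lpa_eqb lpa_eqb_refl lpa_eqb_sym lpa_eqb_trans.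

Definition lpa : Type := {eq_quot lpa_equiv}.

HB.instance Definition _ := Choice.on lpa.
HB.instance Definition _ := EqQuotient.on lpa.

Lemma lpaP a b : \pi_lpa a = \pi_lpa b <-> lpa_eq a b.
Proof. by split=> [/eqmodP/asboolP|h] //; apply/eqmodP/asboolP. Qed.

Lemma lpa_repr a : lpa_eq (repr (\pi_lpa a)) a.
Proof. by apply/lpaP; rewrite reprK. Qed.

Definition lpa_zero : lpa := \pi_lpa Zero.
Definition lpa_add (x y : lpa) : lpa := \pi_lpa (Add (repr x) (repr y)).
Definition lpa_scale (c : R) (x : lpa) : lpa := \pi_lpa (Scale c (repr x)).
Definition lpa_opp (x : lpa) : lpa := lpa_scale (-1) x.
Definition lpa_mul (x y : lpa) : lpa := \pi_lpa (Mul (repr x) (repr y)).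

Lemma pi_add a b : lpa_add (\pi_lpa a) (\pi_lpa b) = \pi_lpa (Add a b).
Proof. by apply/lpaP; apply: rel_add; apply: lpa_repr. Qed.

Lemma pi_scale c a : lpa_scale c (\pi_lpa a) = \pi_lpa (Scale c a).
Proof. by apply/lpaP; apply: rel_scale; apply: lpa_repr. Qed.

Lemma pi_mul a b : lpa_mul (\pi_lpa a) (\pi_lpa b) = \pi_lpa (Mul a b).
Proof. by apply/lpaP; apply: rel_mul; apply: lpa_repr. Qed.

Lemma lpa_addA : associative lpa_add.
Proof.
elim/quotW=> a; elim/quotW=> b; elim/quotW=> c.
by rewrite (pi_add a b) (pi_add b c) !pi_add; apply/lpaP/rel_addA.
Qed.

Lemma lpa_addC : commutative lpa_add.
Proof.
by elim/quotW=> a; elim/quotW=> b; rewrite !pi_add; apply/lpaP/rel_addC.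
Qed.

Lemma lpa_add0 : left_id lpa_zero lpa_add.
Proof. by elim/quotW=> a; rewrite pi_add; apply/lpaP/rel_add0. Qed.

Lemma lpa_addN : left_inverse lpa_zero lpa_opp lpa_add.
Proof.
by elim/quotW=> a; rewrite /lpa_opp (pi_scale _ a) pi_add; apply/lpaP/rel_addN.
Qed.

HB.instance Definition _ :=
  GRing.isZmodule.Build lpa lpa_addA lpa_addC lpa_add0 lpa_addN.

Lemma lpa_scaleA c d (x : lpa) :
  lpa_scale c (lpa_scale d x) = lpa_scale (c * d) x.
Proof.
by elim/quotW: x => a; rewrite (pi_scale d a) !pi_scale; apply/lpaP/rel_scaleA.
Qed.

Lemma lpa_scale1 : left_id 1 lpa_scale.
Proof. by elim/quotW=> a; rewrite pi_scale; apply/lpaP/rel_scale1. Qed.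

Lemma lpa_scaleDr : right_distributive lpa_scale +%R.
Proof.
move=> c; elim/quotW=> a; elim/quotW=> b.
rewrite /GRing.add /= (pi_add a b) (pi_scale c a) (pi_scale c b).
by rewrite pi_scale pi_add; apply/lpaP/rel_scaleDr.
Qed.

Lemma lpa_scaleDl (x : lpa) : {morph lpa_scale^~ x : c d / c + d}.
Proof.
move=> c d; elim/quotW: x => a /=.
rewrite [in RHS]/GRing.add /= (pi_scale c a) (pi_scale d a) pi_add pi_scale.
exact/lpaP/rel_scaleDl.
Qed.

HB.instance Definition _ := GRing.Zmodule_isLmodule.Build R lpa
  lpa_scaleA lpa_scale1 lpa_scaleDr lpa_scaleDl.

Lemma piD a b : \pi_lpa (Add a b) = \pi_lpa a + \pi_lpa b.
Proof. by rewrite -pi_add. Qed.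

Lemma piZ c a : \pi_lpa (Scale c a) = c *: \pi_lpa a.
Proof. by rewrite -pi_scale. Qed.

Lemma pi0 : \pi_lpa Zero = 0.
Proof. by []. Qed.

Lemma lpa_algebra : algebra_law lpa_mul.
Proof.
split.
- elim/quotW=> a; elim/quotW=> b; elim/quotW=> c.
  by rewrite (pi_mul a b) (pi_mul b c) !pi_mul; apply/lpaP/rel_mulA.
- elim/quotW=> a; elim/quotW=> b; elim/quotW=> c.
  rewrite -piD (pi_mul a c) (pi_mul b c) pi_mul -piD.
  exact/lpaP/rel_mulDl.
- elim/quotW=> a; elim/quotW=> b; elim/quotW=> c.
  rewrite -piD (pi_mul a b) (pi_mul a c) pi_mul -piD.
  exact/lpaP/rel_mulDr.
- move=> c; elim/quotW=> a; elim/quotW=> b.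
  by rewrite -piZ (pi_mul a b) pi_mul -piZ; apply/lpaP/rel_scalel.
- move=> c; elim/quotW=> a; elim/quotW=> b.
  by rewrite -piZ (pi_mul a b) pi_mul -piZ; apply/lpaP/rel_scaler.
Qed.

Definition lpa_p (v : vert E) : lpa := \pi_lpa (Vert v).
Definition lpa_s (e : edge E) : lpa := \pi_lpa (Edge e).
Definition lpa_t (e : edge E) : lpa := \pi_lpa (Ghost e).

Lemma pi_sum (l : seq (edge E)) (f : edge E -> lpa_term E R) :
  \pi_lpa (foldr (fun e => Add (f e)) Zero l) = \sum_(e <- l) \pi_lpa (f e).
Proof.
by elim: l => [|e l IH]; rewrite ?big_nil ?big_cons //= piD IH.
Qed.

Lemma lpa_family : leavitt_family lpa_mul lpa_p lpa_s lpa_t.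
Proof.
split; try by move=> *; rewrite pi_mul; apply/lpaP; constructor.
- move=> e f; rewrite pi_mul.
  have <- : \pi_lpa (if e == f then Vert (src e) else Zero)
            = if e == f then lpa_p (src e) else 0 by case: eqP.
  exact/lpaP/rel_ts.
- move=> v l ul hl; under eq_bigr => e _ do rewrite pi_mul.
  by rewrite -pi_sum; apply/lpaP; apply: rel_ck.
Qed.

Theorem lpa_universal (A : lmodType R) (mul : A -> A -> A)
    (p : vert E -> A) (s t : edge E -> A) :
  algebra_law mul -> leavitt_family mul p s t ->
  exists! f : lpa -> A,
    [/\ (forall c x y, f (c *: x + y) = c *: f x + f y),
        (forall x y, f (lpa_mul x y) = mul (f x) (f y)),
        (forall v, f (lpa_p v) = p v) &
        (forall e, f (lpa_s e) = s e) /\ (forall e, f (lpa_t e) = t e)].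
Proof.
move=> aA fA.
pose fix ev (a : lpa_term E R) : A := match a with
  | Vert v => p v | Edge e => s e | Ghost e => t e | Zero => 0
  | Add a b => ev a + ev b | Scale c a => c *: ev a
  | Mul a b => mul (ev a) (ev b) end.
have evP a b : lpa_eq a b -> ev a = ev b.
  elim=> //=; do ?[by move=> *; congruence].
  - by move=> *; rewrite addrA.
  - by move=> *; rewrite addrC.
  - by move=> *; rewrite add0r.
  - by move=> *; rewrite scaleN1r addNr.
  - by move=> *; rewrite scalerA.
  - by move=> *; rewrite scale1r.
  - by move=> *; rewrite scalerDr.
  - by move=> *; rewrite scalerDl.
  - by move=> *; apply: alg_mulA.
  - by move=> *; apply: alg_mulDl.
  - by move=> *; apply: alg_mulDr.
  - by move=> *; apply: alg_scalel.
  - by move=> *; apply: alg_scaler.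
  - by move=> *; apply: (lf_pp fA).
  - by move=> *; apply: (lf_pq fA).
  - by move=> *; apply: (lf_ps fA).
  - by move=> *; apply: (lf_sp fA).
  - by move=> *; apply: (lf_pt fA).
  - by move=> *; apply: (lf_tp fA).
  - by move=> e f; rewrite (lf_ts fA); case: eqP.
  - move=> v l ul hl; rewrite (lf_ck fA ul hl).
    by elim: l {ul hl} => [|e l IH]; rewrite ?big_nil ?big_cons //= IH.
exists (fun x => ev (repr x)); split.
- have evr a : ev (repr (\pi_lpa a)) = ev a by apply/evP/lpa_repr.
  split=> [c|||]; last by split=> e; rewrite evr.
  + by elim/quotW=> a; elim/quotW=> b; rewrite -piZ -piD !evr.
  + by elim/quotW=> a; elim/quotW=> b; rewrite pi_mul !evr.
  + by move=> v; rewrite evr.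
- move=> f [fZD fM fp [fs ft]]; apply/funext => x.
  have f0 : f 0 = 0.
    by have := fZD (-1) 0 0; rewrite scaler0 addr0 scaleN1r addNr.
  have fD y z : f (y + z) = f y + f z by have := fZD 1 y z; rewrite !scale1r.
  have fZ c y : f (c *: y) = c *: f y by have := fZD c y 0; rewrite f0 !addr0.
  rewrite -[in RHS](reprK x).
  elim: (repr x) => /= [v|e|e||a Ha b Hb|c a Ha|a Ha b Hb].
  + exact/esym/fp.
  + exact/esym/fs.
  + exact/esym/ft.
  + by rewrite -[LHS]f0.
  + by rewrite piD fD Ha Hb.
  + by rewrite piZ fZ Ha.
  + by rewrite -pi_mul fM Ha Hb.
Qed.

(* The list [e :: l] stands for a path of positive length; ghost edges are
   multiplied in the reverse order. *)
Fixpoint edges_prod (e : edge E) (l : seq (edge E)) : lpa :=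
  if l is f :: l' then lpa_mul (lpa_s e) (edges_prod f l') else lpa_s e.

Fixpoint ghosts_prod (e : edge E) (l : seq (edge E)) : lpa :=
  if l is f :: l' then lpa_mul (ghosts_prod f l') (lpa_t e) else lpa_t e.

Definition lpa_path (mu : fpath E) : lpa :=
  if pedges mu is e :: l then edges_prod e l else lpa_p (prng mu).

Definition lpa_ghost (mu : fpath E) : lpa :=
  if pedges mu is e :: l then ghosts_prod e l else lpa_p (prng mu).

Definition lpa_diag : set lpa :=
  [set x | exists (n : nat) (c : 'I_n -> R) (mu : 'I_n -> fpath E),
     x = \sum_(i < n) c i *: lpa_mul (lpa_path (mu i)) (lpa_ghost (mu i))].

End LeavittPathAlgebra.

Arguments lpa_diag E R _ : clear implicits.

Section Involution.
Variables (E : digraph) (R : comNzRingType) (conj : {rmorphism R -> R}).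
Implicit Types (a b : lpa_term E R).

Fixpoint term_star (a : lpa_term E R) : lpa_term E R :=
  match a with
  | Vert v => Vert v
  | Edge e => Ghost e
  | Ghost e => Edge e
  | Zero => Zero
  | Add a b => Add (term_star a) (term_star b)
  | Scale c a => Scale (conj c) (term_star a)
  | Mul a b => Mul (term_star b) (term_star a)
  end.

Lemma term_star_eq a b : lpa_eq a b -> lpa_eq (term_star a) (term_star b).
Proof.
elim=> /=; try by move=> *; constructor.
- by move=> x y z _ h1 _ h2; apply: rel_trans h1 h2.
- by move=> x; rewrite rmorphN1; constructor.
- by move=> c d x; rewrite rmorphM; constructor.
- by move=> x; rewrite rmorph1; constructor.
- by move=> x c d; rewrite rmorphD; constructor.
- by move=> x y z; apply/rel_sym; constructor.
- by move=> v w; rewrite eq_sym; constructor.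
- by move=> e f; have := rel_ts R f e; rewrite eq_sym; case: eqP => // ->.
- move=> v l ul hl; have := rel_ck R ul hl.
  set u := foldr _ _ _; suff -> : term_star u = u by [].
  by rewrite /u; elim: l {ul hl u} => //= e l ->.
Qed.

Definition lpa_star (x : lpa E R) : lpa E R :=
  \pi_(lpa E R) (term_star (repr x)).

Lemma pi_star a :
  lpa_star (\pi_(lpa E R) a) = \pi_(lpa E R) (term_star a).
Proof. exact/lpaP/term_star_eq/lpa_repr. Qed.

Lemma lpa_starD x y : lpa_star (x + y) = lpa_star x + lpa_star y.
Proof.
by elim/quotW: x => a; elim/quotW: y => b; rewrite -piD !pi_star -piD.
Qed.

Lemma lpa_starZ c x : lpa_star (c *: x) = conj c *: lpa_star x.
Proof. by elim/quotW: x => a; rewrite -piZ !pi_star -piZ. Qed.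

Lemma lpa_starM x y :
  lpa_star (lpa_mul x y) = lpa_mul (lpa_star y) (lpa_star x).
Proof.
by elim/quotW: x => a; elim/quotW: y => b; rewrite pi_mul !pi_star pi_mul.
Qed.

Lemma lpa_starK : involutive conj -> involutive lpa_star.
Proof.
move=> cK; elim/quotW=> a; rewrite (pi_star a) pi_star; congr (\pi_(lpa E R) _).
by elim: a => /= [||||a -> b ->|c a ->|a -> b ->] //; rewrite cK.
Qed.

Lemma lpa_star_path mu : lpa_star (lpa_path R mu) = lpa_ghost R mu.
Proof.
rewrite /lpa_path /lpa_ghost; case: (pedges mu) => [|e l]; first exact: pi_star.
elim: l e => [|f l IH] e /=; first exact: pi_star.
by rewrite lpa_starM IH /lpa_s pi_star.
Qed.

Lemma lpa_star_ghost mu : lpa_star (lpa_ghost R mu) = lpa_path R mu.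
Proof.
rewrite /lpa_path /lpa_ghost; case: (pedges mu) => [|e l]; first exact: pi_star.
elim: l e => [|f l IH] e /=; first exact: pi_star.
by rewrite lpa_starM IH /lpa_t pi_star.
Qed.

Lemma lpa_star_monomial c mu nu :
  lpa_star (c *: lpa_mul (lpa_path R mu) (lpa_ghost R nu)) =
  conj c *: lpa_mul (lpa_path R nu) (lpa_ghost R mu).
Proof. by rewrite lpa_starZ lpa_starM lpa_star_path lpa_star_ghost. Qed.

End Involution.

(* No [R]-linearity is required. *)
Record ring_star_iso (E F : digraph) (R : comNzRingType)
    (conj : {rmorphism R -> R}) (f : lpa E R -> lpa F R) : Prop :=
  RingStarIso {
  rsi_bij : bijective f;
  rsi_add : forall x y, f (x + y) = f x + f y;
  rsi_mul : forall x y, f (lpa_mul x y) = lpa_mul (f x) (f y);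
  rsi_star : forall x, f (lpa_star conj x) = lpa_star conj (f x) }.

(* Main.v *)
From mathcomp Require Import all_boot all_order all_algebra.
From mathcomp Require Import boolp classical_sets functions.
From mathcomp Require Import cardinality fsbigop filter topology.
From mathcomp Require Import zify.
Require Import Defs.

Set Implicit Arguments.
Unset Strict Implicit.
Unset Printing Implicit Defensive.

Import GRing.Theory.
Local Open Scope classical_set_scope.
Local Open Scope ring_scope.
Local Open Scope quotient_scope.

(** Both sides of the equivalence are read off from functions on the groupoid.
    The Leavitt path algebra acts on functions of an infinite path and an
    integer: an edge removes itself from the front of the path, a ghost edge puts
    itself back, and the integer records the change of length.  The coefficient
    [rho a g] of an element [a] at an arrow [g] is the matrix entry of this
    action between the endpoints of [g].  Then [s_mu s_nu^*] is sent to the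
    indicator of its cylinder, products to convolutions ([rhoM]) and the
    involution to [g |-> conj (a g^-1)] ([rho_star]).  As the graph is row-finite,
    the relation [p_v = sum s_e s_e^*] rewrites any element as a combination of
    monomials [s_mu s_nu^*] in which all [nu] have the same length.  Such
    cylinders are disjoint, and nonempty without sources, so the coefficients of
    the combination are values of [rho a].  Hence [rho] is injective ([rho_inj]),
    and the diagonal consists of the elements supported on units ([lpa_diagP]).

    A groupoid isomorphism that is a homeomorphism carries convolution, inversion
    and units of one groupoid to those of the other, so it only remains to see
    that it carries the image of [rho] to the image of [rho].  This holds because
    cylinders are compact: the image of the indicator of a cylinder is locally
    constant with compact support, hence a finite combination of indicators of
    cylinders.  Compactness enters as an induction along paths: a property of
    cylinders that follows from the same property for the finitely many one-edge
    extensions need only be checked near each arrow ([cylinder_bar]).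

    Conversely, a diagonal-preserving star-isomorphism [f] preserves the
    normalizers of the diagonal: the elements [n] such that [n D n^*] and
    [n^* D n] lie in [D].  The heart of the matter is that the support of a
    normalizer is a bisection ([normalizer_src_inj]).  If [h1] and [h0] are
    arrows of the support with the same source, [h1] of the largest degree over
    its range and [h0] of the smallest over its own, then [n d n^*] takes the
    value [n(h1) * conj n(h0)] at [h1 h0^-1] for a small projection [d] at the
    source.  This is nonzero in a domain, so [h1 h0^-1] is a unit; comparing
    extremal arrows in this way leaves a single arrow over each source.  On the
    diagonals [f] induces a bijection of infinite paths ([unit_rel_total],
    by compactness again).  An arrow [g] now corresponds to the unique arrow over
    the image of its source at which [f n] does not vanish, for any normalizer
    [n] that does not vanish at [g]; that this does not depend on [n]
    ([arrow_image_indep]) is seen from the diagonal elements [n^* m d].  The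
    correspondence is multiplicative because products of normalizers are
    normalizers, and continuous because the preimage of a cylinder is the
    support of an element of the algebra. *)

(** * Monomials in a Leavitt path algebra *)

Section Monomials.
Variables (E : digraph) (R : comNzRingType).
Local Notation L := (lpa E R).
Local Notation "x ** y" := (lpa_mul x y) (at level 40, left associativity).
Local Notation p := (lpa_p R).
Local Notation s := (lpa_s R).
Local Notation t := (lpa_t R).
Implicit Types (x y z : L) (v w : vert E) (e : edge E) (mu nu : fpath E).

Let aA := @lpa_algebra E R.
Let lf := @lpa_family E R.

Lemma lpa_mul0l x : 0 ** x = 0.
Proof. by have := alg_scalel aA 0 0 x; rewrite !scale0r. Qed.

Lemma lpa_mul0r x : x ** 0 = 0.
Proof. by have := alg_scaler aA 0 x 0; rewrite !scale0r. Qed.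

Lemma lpa_mul_sumr (I : Type) (r : seq I) x (F : I -> L) :
  x ** (\sum_(i <- r) F i) = \sum_(i <- r) x ** F i.
Proof.
apply: (big_morph _ (fun a b => alg_mulDr aA x a b)); exact: lpa_mul0r.
Qed.

Lemma lpa_mul_suml (I : Type) (r : seq I) x (F : I -> L) :
  (\sum_(i <- r) F i) ** x = \sum_(i <- r) F i ** x.
Proof.
apply: (big_morph (fun a => a ** x) (fun a b => alg_mulDl aA a b x)).
exact: lpa_mul0l.
Qed.

Definition edges_mul (l : seq (edge E)) x : L := foldr (fun e y => s e ** y) x l.
Definition ghosts_mul (l : seq (edge E)) x : L := foldr (fun e y => y ** t e) x l.

Lemma edges_mulM l x y : edges_mul l x ** y = edges_mul l (x ** y).
Proof. by elim: l => //= e l IH; rewrite -(alg_mulA aA) IH. Qed.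

Lemma ghosts_mulM l x y : y ** ghosts_mul l x = ghosts_mul l (y ** x).
Proof. by elim: l => //= e l IH; rewrite (alg_mulA aA) IH. Qed.

Lemma edges_mul_sum (I : Type) (r : seq I) l (F : I -> L) :
  edges_mul l (\sum_(i <- r) F i) = \sum_(i <- r) edges_mul l (F i).
Proof. by elim: l => //= e l ->; rewrite lpa_mul_sumr. Qed.

Lemma ghosts_mul_sum (I : Type) (r : seq I) l (F : I -> L) :
  ghosts_mul l (\sum_(i <- r) F i) = \sum_(i <- r) ghosts_mul l (F i).
Proof. by elim: l => //= e l ->; rewrite lpa_mul_suml. Qed.

Lemma ghosts_mul0 l : ghosts_mul l 0 = 0.
Proof. by elim: l => //= e l ->; rewrite lpa_mul0l. Qed.

Lemma lpa_pathE mu : lpa_path R mu = edges_mul (pedges mu) (p (psrc mu)).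
Proof.
rewrite /lpa_path /psrc; case: (pedges mu) => [//|e l] /=.
by elim: l e => [|f l IH] e /=; rewrite ?(lf_sp lf) // IH.
Qed.

Lemma lpa_ghostE mu : lpa_ghost R mu = ghosts_mul (pedges mu) (p (psrc mu)).
Proof.
rewrite /lpa_ghost /psrc; case: (pedges mu) => [//|e l] /=.
by elim: l e => [|f l IH] e /=; rewrite ?(lf_pt lf) // IH.
Qed.

Definition mono mu nu : L := lpa_path R mu ** lpa_ghost R nu.

(** The word [l l'^*] through the vertex [v], without any condition on [l] and
    [l'] so that the set of these words is visibly stable under the
    generators. *)
Definition lword (l l' : seq (edge E)) v : L := edges_mul l (ghosts_mul l' (p v)).

Lemma lwordE l l' v : lword l l' v = edges_mul l (p v) ** ghosts_mul l' (p v).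
Proof. by rewrite edges_mulM ghosts_mulM (lf_pp lf). Qed.

Lemma monoE mu nu : psrc mu = psrc nu ->
  mono mu nu = lword (pedges mu) (pedges nu) (psrc mu).
Proof. by move=> e; rewrite lwordE /mono lpa_pathE lpa_ghostE -e. Qed.

Lemma lword_ck l l' v (r : seq (edge E)) : uniq r ->
  (forall e, (e \in r) = (rng e == v)) ->
  lword l l' v = \sum_(e <- r) lword (rcons l e) (rcons l' e) (src e).
Proof.
move=> ur hr; rewrite /lword (lf_ck lf ur hr) ghosts_mul_sum edges_mul_sum.
apply: eq_bigr => e _; rewrite -cats1 -cats1 /edges_mul /ghosts_mul.
rewrite !foldr_cat /= -/(edges_mul _ _) -/(ghosts_mul _ _) (lf_pt lf).
by rewrite -/(ghosts_mul _ _) ghosts_mulM.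
Qed.

Lemma lpa_star0 (c : {rmorphism R -> R}) : lpa_star c (0 : L) = 0.
Proof. exact: pi_star. Qed.

Lemma star_edges_mul (c : {rmorphism R -> R}) l v :
  lpa_star c (edges_mul l (p v)) = ghosts_mul l (p v).
Proof.
elim: l => /= [|e l IH]; first exact: pi_star.
by rewrite lpa_starM IH /lpa_s pi_star.
Qed.

Lemma edges_mul_valid l v : edges_mul l (p v) = 0 \/
  exists mu, [/\ pedges mu = l, psrc mu = v &
    p (prng mu) ** edges_mul l (p v) = edges_mul l (p v)].
Proof.
elim: l => [|e l [h|[mu [el em IH]]]] /=.
- right; exists (@FPath E v [::] isT); split=> //=; exact: (lf_pp lf).
- by left; rewrite h lpa_mul0r.
have [ev|nv] := eqVneq (src e) (prng mu).
  right; have hp : is_path (rng e) (e :: l).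
    by rewrite /= eqxx ev /=; move: (pathP mu); rewrite el.
  exists (FPath hp); split=> //=.
    by rewrite /psrc /=; move: em; rewrite /psrc el ev.
  by rewrite (alg_mulA aA) (lf_ps lf).
left; rewrite -IH (alg_mulA aA) -(lf_sp lf) -(alg_mulA aA (s e)).
by rewrite (lf_pq lf nv) lpa_mul0r lpa_mul0l.
Qed.

(** A word is zero unless both of its factors are paths ending in the middle
    vertex. *)
Lemma lword_valid l l' v : lword l l' v = 0 \/
  exists mu nu, [/\ pedges mu = l, pedges nu = l', psrc mu = psrc nu &
                    lword l l' v = mono mu nu].
Proof.
rewrite lwordE.
have [->|[mu [el em _]]] := edges_mul_valid l v; first by left; rewrite lpa_mul0l.
(* The case of the ghost factor is the image of that of the edges under the
   involution built on the identity of R. *)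
have := edges_mul_valid l' v; rewrite -(star_edges_mul idfun l').
move=> [->|[nu [el' en _]]].
  by left; rewrite lpa_star0 lpa_mul0r.
right; exists mu, nu; rewrite star_edges_mul -lwordE; split=> //; first by rewrite em.
by rewrite monoE ?em ?el ?el' ?en.
Qed.

Definition term_eval (i : R * (fpath E * fpath E)) : L := i.1 *: mono i.2.1 i.2.2.

Definition balanced (P : seq (R * (fpath E * fpath E))) : Prop :=
  forall i, List.In i P -> psrc i.2.1 = psrc i.2.2.

Definition spanned x : Prop :=
  exists P, balanced P /\ x = \sum_(i <- P) term_eval i.

Lemma balanced_cons i P : balanced (i :: P) <->
  psrc i.2.1 = psrc i.2.2 /\ balanced P.
Proof.
split=> [h|[h1 h2] j /= [<-//|hj]]; last exact: h2.
by split=> [|j hj]; apply: h; [left | right].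
Qed.

Lemma spanned0 : spanned 0.
Proof. by exists [::]; split=> [i []|]; rewrite big_nil. Qed.

Lemma spannedD x y : spanned x -> spanned y -> spanned (x + y).
Proof.
move=> [P [bP ->]] [Q [bQ ->]]; exists (P ++ Q); rewrite big_cat; split=> // i.
by move=> hi; case: (List.in_app_or P Q i hi) => [/bP|/bQ].
Qed.

Lemma spannedZ c x : spanned x -> spanned (c *: x).
Proof.
move=> [P [bP ->]]; exists [seq (c * i.1, i.2) | i <- P]; split; last first.
  rewrite big_map scaler_sumr; apply: eq_bigr => i _.
  by rewrite /term_eval /= scalerA.
elim: P bP => [|i P IH] //= /balanced_cons[bi bP].
by apply/balanced_cons; split=> //; apply: IH.
Qed.

Lemma spanned_mono mu nu : psrc mu = psrc nu -> spanned (mono mu nu).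
Proof.
move=> e; exists [:: (1, (mu, nu))]; rewrite big_seq1 /term_eval scale1r.
by split=> // i [<-|[]].
Qed.

Lemma spanned_lword l l' v : spanned (lword l l' v).
Proof.
have [->|[mu [nu [_ _ e ->]]]] := lword_valid l l' v; first exact: spanned0.
exact: spanned_mono.
Qed.

Lemma spanned_ind (P : L -> Prop) : P 0 -> (forall x y, P x -> P y -> P (x + y)) ->
  (forall c x, P x -> P (c *: x)) ->
  (forall mu nu, psrc mu = psrc nu -> P (mono mu nu)) ->
  forall x, spanned x -> P x.
Proof.
move=> P0 PD PZ Pm x [Q [bQ ->]]; elim: Q bQ => [|i Q IH]; first by rewrite big_nil.
move=> /balanced_cons[bi bQ]; rewrite big_cons; apply: PD (IH bQ).
exact/PZ/Pm.
Qed.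

Lemma spanned_mull x : (forall l l' v, spanned (x ** lword l l' v)) ->
  forall y, spanned y -> spanned (x ** y).
Proof.
move=> h; apply: spanned_ind => [|y z hy hz|c y hy|mu nu e].
- by rewrite lpa_mul0r; apply: spanned0.
- by rewrite (alg_mulDr aA); apply: spannedD.
- by rewrite (alg_scaler aA); apply: spannedZ.
- by rewrite monoE.
Qed.

Lemma spanned_vert w l l' v : spanned (p w ** lword l l' v).
Proof.
case: l => [|f l].
  rewrite /lword /= ghosts_mulM; have [->|wv] := eqVneq w v.
    by rewrite (lf_pp lf); apply: (spanned_lword [::]).
  by rewrite (lf_pq lf wv) ghosts_mul0; apply: spanned0.
rewrite /lword /= (alg_mulA aA); have [->|wf] := eqVneq w (rng f).
  by rewrite (lf_ps lf); apply: (spanned_lword (f :: l)).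
rewrite -(lf_ps lf) (alg_mulA aA) (lf_pq lf wf) !lpa_mul0l; exact: spanned0.
Qed.

Lemma spanned_ghost e l l' v : spanned (t e ** lword l l' v).
Proof.
case: l => [|f l].
  rewrite /lword /= ghosts_mulM; have [<-|wv] := eqVneq (rng e) v.
    have -> : ghosts_mul l' (t e ** p (rng e)) = lword [::] (rcons l' e) (src e).
      rewrite /lword /= -cats1 /ghosts_mul foldr_cat /=.
      by rewrite (lf_tp lf) (lf_pt lf).
    exact: spanned_lword.
  rewrite -(lf_tp lf) -(alg_mulA aA) (lf_pq lf wv) lpa_mul0r ghosts_mul0.
  exact: spanned0.
rewrite /lword /= (alg_mulA aA) (lf_ts lf); case: eqP => _.
  exact: (spanned_vert _ l).
rewrite lpa_mul0l; exact: spanned0.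
Qed.

(** Left multiplication by a generator sends words to words or to zero, so the
    span of the monomials is a left ideal; it contains the generators. *)
Lemma lpa_spanned x : spanned x.
Proof.
suff [] : spanned x /\ forall y, spanned y -> spanned (x ** y) by [].
elim/quotW: x => a; elim: a => [v|e|e||a [Ha Ma] b [Hb Mb]|c a [Ha Ma]|
    a [Ha Ma] b [Hb Mb]].
- split; first exact: (spanned_lword [::] [::]).
  exact/spanned_mull/spanned_vert.
- split; last by apply: spanned_mull => l l' v; apply: (spanned_lword (e :: l)).
  have := spanned_lword [:: e] [::] (src e); rewrite /lword /=.
  by rewrite (lf_sp lf).
- split; last exact/spanned_mull/spanned_ghost.
  have := spanned_lword [::] [:: e] (src e); rewrite /lword /=.
  by rewrite (lf_pt lf).
- by rewrite pi0; split=> [|y _]; rewrite ?lpa_mul0l; apply: spanned0.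
- rewrite piD; split=> [|y hy]; first exact: spannedD.
  by rewrite (alg_mulDl aA); apply: spannedD; [apply: Ma | apply: Mb].
- rewrite piZ; split=> [|y hy]; first exact: spannedZ.
  by rewrite (alg_scalel aA); apply/spannedZ/Ma.
- rewrite -pi_mul; split=> [|y hy]; first exact: Ma.
  by rewrite -(alg_mulA aA); apply/Ma/Mb.
Qed.

(** As monomials span, an additive and homogeneous statement only needs to be
    checked on them. *)
Lemma lpa_ind (P : L -> Prop) : P 0 -> (forall x y, P x -> P y -> P (x + y)) ->
  (forall c x, P x -> P (c *: x)) ->
  (forall mu nu, psrc mu = psrc nu -> P (mono mu nu)) -> forall x, P x.
Proof. by move=> P0 PD PZ Pm x; apply: spanned_ind (lpa_spanned x). Qed.

End Monomials.

(** * Expanding monomials to a common length *)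

Section Level.
Variables (E : digraph) (R : comNzRingType).
Hypothesis rfE : row_finite E.
Local Notation L := (lpa E R).
Implicit Types (x y : L) (mu nu : fpath E).

Lemma row_enum (v : vert E) : exists l : seq (edge E), uniq l /\
  forall e, (e \in l) = (rng e == v).
Proof.
have /finite_seqP[l hl] := rfE v.
exists (undup l); split; first exact: undup_uniq.
move=> e; rewrite mem_undup; apply/idP/eqP => h.
  by have : [set` l] e by []; rewrite -hl.
by have : [set e : edge E | rng e = v] e by []; rewrite hl.
Qed.

Definition leveled N x : Prop := exists P : seq (R * (fpath E * fpath E)),
  [/\ balanced P, (forall i, List.In i P -> plen i.2.2 = N) &
      x = \sum_(i <- P) term_eval i].

Lemma leveled0 N : leveled N 0.
Proof. by exists [::]; split=> [i []|i []|]; rewrite big_nil. Qed.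

Lemma leveledD N x y : leveled N x -> leveled N y -> leveled N (x + y).
Proof.
move=> [P [bP lP ->]] [Q [bQ lQ ->]]; exists (P ++ Q); rewrite big_cat.
split=> // i hi.
  by case: (List.in_app_or P Q i hi) => [/bP|/bQ].
by case: (List.in_app_or P Q i hi) => [/lP|/lQ].
Qed.

Lemma leveledZ N c x : leveled N x -> leveled N (c *: x).
Proof.
move=> [P [bP lP ->]]; exists [seq (c * i.1, i.2) | i <- P].
have h j : List.In j [seq (c * i.1, i.2) | i <- P] ->
    exists2 i, List.In i P & i.2 = j.2.
  elim: (P) => //= i Q IH [<-|/IH[k hk e]]; first by exists i; [left|].
  by exists k; [right|].
split=> [j /h[i /bP + <-]//|j /h[i /lP + <-]//|].
rewrite big_map scaler_sumr; apply: eq_bigr => i _.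
by rewrite /term_eval /= scalerA.
Qed.

Lemma leveled_mono k mu nu : psrc mu = psrc nu ->
  leveled (plen nu + k) (mono R mu nu).
Proof.
elim: k mu nu => [|k IH] mu nu e.
  exists [:: (1, (mu, nu))]; rewrite big_seq1 /term_eval scale1r addn0.
  by split=> // i [<-|[]].
have [r [ur hr]] := row_enum (psrc mu).
rewrite monoE // (lword_ck _ _ _ ur hr); elim: (r) => [|f r' IHr].
  by rewrite big_nil; apply: leveled0.
rewrite big_cons; apply: leveledD => //.
have [->|[mu' [nu' [_ en' e' ->]]]] :=
    lword_valid R (rcons (pedges mu) f) (rcons (pedges nu) f) (src f).
  exact: leveled0.
have -> : (plen nu + k.+1 = plen nu' + k)%N by rewrite /plen en' size_rcons addSnnS.
exact: IH.
Qed.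

(** The lengths of the second paths can be raised by inserting
    [p_v = sum s_e s_e^*] between the two factors of a monomial. *)
Lemma lpa_leveled x : exists N0, forall N, (N0 <= N)%N -> leveled N x.
Proof.
elim/lpa_ind: x => [|x y [n hx] [m hy]|c x [n hx]|mu nu e].
- by exists 0%N => N _; apply: leveled0.
- by exists (maxn n m) => N; rewrite geq_max => /andP[/hx ? /hy ?]; apply: leveledD.
- by exists n => N /hx; apply: leveledZ.
- by exists (plen nu) => N /subnKC <-; apply: leveled_mono.
Qed.

End Level.

(** * The action on functions of an infinite path and a degree *)

Section Action.
Variables (E : digraph) (R : comNzRingType).
Local Notation L := (lpa E R).
Local Notation V := (ipath E -> int -> R).
Implicit Types (x y z : ipath E) (xi eta : V) (e : edge E) (mu nu : fpath E).

Lemma icons_subproof e x : src e = irng x ->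
  forall i, src (if i is j.+1 then x j else e) = rng (x i).
Proof. by move=> ex [|i] //; apply: ipathP. Qed.

(** The path [e x], with the junk value [x] when [e] does not end at [x]. *)
Definition icons e x : ipath E :=
  match pselect (src e = irng x) with
  | left h => @IPath E (fun i => if i is j.+1 then x j else e) (icons_subproof h)
  | right _ => x
  end.

Lemma iconsE e x i : src e = irng x ->
  icons e x i = if i is j.+1 then x j else e.
Proof. by move=> h; rewrite /icons; case: pselect. Qed.

Lemma icons_shift x : icons (x 0%N) (ipath_shift 1 x) = x.
Proof.
apply: ipath_ext => i; rewrite iconsE; first by case: i.
by rewrite ipathP.
Qed.

Lemma shift_icons e x : src e = irng x -> ipath_shift 1 (icons e x) = x.
Proof. by move=> h; apply: ipath_ext => i /=; rewrite iconsE. Qed.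

Lemma irng_shift1 x : irng (ipath_shift 1 x) = src (x 0%N).
Proof. by rewrite ipathP. Qed.

(** An edge shortens the path and lowers the degree, a ghost edge undoes this. *)
Fixpoint ev (a : lpa_term E R) (xi : V) (x : ipath E) (k : int) : R :=
  match a with
  | Vert v => if irng x == v then xi x k else 0
  | Edge e => if x 0%N == e then xi (ipath_shift 1 x) (k - 1) else 0
  | Ghost e => if src e == irng x then xi (icons e x) (k + 1) else 0
  | Zero => 0
  | Add a b => ev a xi x k + ev b xi x k
  | Scale c a => c * ev a xi x k
  | Mul a b => ev a (ev b xi) x k
  end.

Lemma ev_lin a c xi eta x k :
  ev a (fun y l => c * xi y l + eta y l) x k = c * ev a xi x k + ev a eta x k.
Proof.
elim: a xi eta x k => /= [v|e|e||a IHa b IHb|d a IHa|a IHa b IHb] xi eta x k.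
- by case: eqP => _; rewrite ?mulr0 ?addr0.
- by case: eqP => _; rewrite ?mulr0 ?addr0.
- by case: eqP => _; rewrite ?mulr0 ?addr0.
- by rewrite mulr0 addr0.
- by rewrite IHa IHb mulrDr; rewrite addrACA.
- by rewrite IHa mulrDr !mulrA (mulrC d).
- rewrite -IHa; congr (ev a _ x k); apply/funext => y; apply/funext => l.
  exact: IHb.
Qed.

Lemma ev0 a x k : ev a (fun _ _ => 0) x k = 0.
Proof.
pose f : V := fun _ _ => 0.
have e : (fun y l => -1 * f y l + f y l) = f.
  by apply/funext => y; apply/funext => l; rewrite mulr0 addr0.
by have := ev_lin a (-1) f f x k; rewrite e mulN1r addNr.
Qed.

Lemma evP a b : lpa_eq a b -> ev a = ev b.
Proof.
have ex (f g : V -> V) : (forall xi x k, f xi x k = g xi x k) -> f = g.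
  by move=> h; apply/funext => xi; apply/funext => x; apply/funext => k.
elim.
- by [].
- by [].
- by move=> a0 b0 c _ -> _ ->.
- by move=> a0 a' b0 b' _ ha _ hb; apply: ex => xi x k /=; rewrite ha hb.
- by move=> c a0 a' _ ha; apply: ex => xi x k /=; rewrite ha.
- by move=> a0 a' b0 b' _ ha _ hb; apply: ex => xi x k /=; rewrite ha hb.
- by move=> *; apply: ex => xi x k /=; rewrite addrA.
- by move=> *; apply: ex => xi x k /=; rewrite addrC.
- by move=> *; apply: ex => xi x k /=; rewrite add0r.
- by move=> *; apply: ex => xi x k /=; rewrite mulN1r addNr.
- by move=> *; apply: ex => xi x k /=; rewrite mulrA.
- by move=> *; apply: ex => xi x k /=; rewrite mul1r.
- by move=> *; apply: ex => xi x k /=; rewrite mulrDr.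
- by move=> *; apply: ex => xi x k /=; rewrite mulrDl.
- by [].
- by [].
- move=> a0 b0 c; apply: ex => xi x k /=.
  have := ev_lin a0 1 (ev b0 xi) (ev c xi) x k; rewrite mul1r => <-.
  congr (ev a0 _ x k); apply/funext => y; apply/funext => l; by rewrite mul1r.
- by [].
- move=> c a0 b0; apply: ex => xi x k /=.
  have := ev_lin a0 c (ev b0 xi) (fun _ _ => 0) x k; rewrite ev0 addr0 => <-.
  congr (ev a0 _ x k); apply/funext => y; apply/funext => l; by rewrite addr0.
(* From here on, the defining relations of the Leavitt path algebra. *)
- by move=> v; apply: ex => xi x k /=; case: eqP.
- move=> v w vw; apply: ex => xi x k /=; case: eqP => // ->.
  by rewrite (negbTE vw).
- move=> e; apply: ex => xi x k /=; case: eqP => //.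
  by case: eqP => // <- [].
- move=> e; apply: ex => xi x k /=; case: eqP => // <-.
  by rewrite irng_shift1 eqxx.
- move=> e; apply: ex => xi x k /=; by rewrite eq_sym; case: eqP.
- move=> e; apply: ex => xi x k /=; case: eqP => // h.
  by rewrite /irng iconsE // eqxx.
- move=> e f; apply: ex => xi x k /=.
  case: (eqVneq e f) => [<-|ne]; last first.
    by case: eqP => // h; rewrite iconsE //= (negbTE ne).
  rewrite /= eq_sym; case: eqP => // h.
  by rewrite iconsE // eqxx shift_icons // addrK.
- move=> v l ul hl; apply: ex => xi x k.
  have -> : forall r : seq (edge E), ev (foldr (fun e a0 => Add (Mul (Edge e) (Ghost e)) a0) Zero r)
     xi x k = \sum_(e <- r) (if e == x 0%N then xi x k else 0).
    elim=> [|e r IH] /=; first by rewrite big_nil.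
    rewrite big_cons IH eq_sym; congr (_ + _); case: eqP => // ->.
    by rewrite irng_shift1 eqxx icons_shift subrK.
  have := hl (x 0%N); rewrite /= -/(irng x) => <-; case: ifP => h; last first.
    by rewrite big1_seq // => e /andP[_ el]; case: eqP => // ee; rewrite -ee el in h.
  rewrite (bigD1_seq _ h ul) eqxx /= big1 ?addr0 // => e ne.
  by rewrite (negbTE ne).
Qed.

Definition act (a : L) : V -> V := ev (repr a).

Lemma act_pi a : act (\pi_L a) = ev a.
Proof. exact/evP/lpa_repr. Qed.

Lemma actM (a b : L) xi : act (lpa_mul a b) xi = act a (act b xi).
Proof. by rewrite act_pi. Qed.

Lemma actD (a b : L) xi x k : act (a + b) xi x k = act a xi x k + act b xi x k.
Proof. by elim/quotW: a => a; elim/quotW: b => b; rewrite -piD !act_pi. Qed.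

Lemma actZ c (a : L) xi x k : act (c *: a) xi x k = c * act a xi x k.
Proof. by elim/quotW: a => a; rewrite -piZ !act_pi. Qed.

Lemma act0 xi x k : act 0 xi x k = 0.
Proof. by rewrite -pi0 act_pi. Qed.

(** The product of [s_mu] and [a] sees only the paths that begin with [mu], and
    there it is [a] at their tails. *)
Lemma act_edges l (a : L) xi x k : act (edges_mul l a) xi x k =
  if [seq x i | i <- iota 0 (size l)] == l
  then act a xi (ipath_shift (size l) x) (k - (size l)%:Z) else 0.
Proof.
elim: l x k => [|e l IH] x k /=.
  by rewrite subr0; congr (act a xi _ _); apply: ipath_ext.
rewrite actM /lpa_s act_pi /= eqseq_cons; case: eqP => //= _.
rewrite IH (iotaDl 1 0) -map_comp; congr (if _ then _ else _).
congr (act a xi _ _); last by lia.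
by apply: ipath_ext => i /=; rewrite add1n addSn.
Qed.

Lemma is_cat_icons e (l : seq (edge E)) v (h : is_path v (e :: l)) z y :
  is_cat (FPath (proj2 (andP h))) z y -> is_cat (FPath h) z (icons e y).
Proof.
move=> hc; have [ez hz] := hc; split; first by rewrite ez /psrc.
have ey : src e = irng y by have /is_catP[/(congr1 (@prng E))] := hc.
by move=> i; rewrite iconsE //; case: i => [//|i]; rewrite hz /plen /= ltnS subSS.
Qed.

Lemma act_ghost_cat nu z y xi k : is_cat nu z y ->
  act (ghosts_mul (pedges nu) (lpa_p R (psrc nu))) xi z k = xi y (k + (plen nu)%:Z).
Proof.
case: nu => v l; elim: l v xi y k => [|e l IH] v xi y k h /=.
  move=> [ez hz]; rewrite /lpa_p act_pi /= ez eqxx addr0; congr (xi _ _).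
  by apply: ipath_ext => i; rewrite hz /= subn0.
move=> hc; rewrite actM.
have /is_catP[h1 h2] := hc.
have hc' : is_cat (FPath (proj2 (andP h))) z (ipath_shift 1 y).
  have [ez hz] := hc; split; first by rewrite ez.
  by move=> i /=; rewrite hz /plen /= add1n ltnS subSS.
have ey0 : y 0%N = e by have [_ ->] := hc.
rewrite /psrc /= (IH _ _ _ _ _ hc') /lpa_t act_pi /= irng_shift1 ey0 eqxx.
have -> : icons e (ipath_shift 1 y) = y by have := icons_shift y; rewrite ey0.
by rewrite /plen /=; congr (xi y _); lia.
Qed.

Lemma act_ghost0 l v xi z k : irng z != v ->
  act (ghosts_mul l (lpa_p R v)) xi z k = 0.
Proof.
move=> zv; elim: l xi => [|e l IH] xi /=; last by rewrite actM IH.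
by rewrite /lpa_p act_pi /= (negbTE zv).
Qed.

Lemma is_cat_ex nu z : irng z = psrc nu -> exists y, is_cat nu z y.
Proof.
case: nu => v l; elim: l v => [|e l IH] v h /= ez.
  by exists z; split=> // i; rewrite subn0.
have [y hy] := IH _ (proj2 (andP h)) ez.
by exists (icons e y); apply: is_cat_icons.
Qed.

Lemma act_mono1 mu nu z x y xi k : psrc mu = psrc nu -> is_cat mu z x ->
  is_cat nu z y -> act (mono R mu nu) xi x k = xi y (k - (plen mu)%:Z + (plen nu)%:Z).
Proof.
move=> e cx cy; rewrite monoE // act_edges.
have /is_catP[emu ez] := cx.
have -> : [seq x i | i <- iota 0 (size (pedges mu))] = pedges mu by rewrite {2}emu.
by rewrite eqxx -ez e (act_ghost_cat _ _ cy).
Qed.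

Lemma act_mono0 mu nu x xi k : psrc mu = psrc nu -> (forall z, ~ is_cat mu z x) ->
  act (mono R mu nu) xi x k = 0.
Proof.
move=> e h; rewrite monoE // act_edges; case: eqP => // em.
apply: act_ghost0; apply/eqP => ez; apply: (h (ipath_shift (plen mu) x)).
apply/is_catP; split=> //; apply: fpath_ext => //=.
rewrite -[RHS]/(irng x); move: em ez; rewrite /psrc /plen.
case: (mu) => v [|f l] hl /=; last first.
  by move=> [ef _] _; case/andP: hl => /eqP <- _; rewrite -ef.
by move=> _ <-; rewrite /irng /= addn0.
Qed.

End Action.

(** * Cylinders *)

Section Cylinders.
Variable E : digraph.
Implicit Types (x y z : ipath E) (mu nu : fpath E) (g h k : graph_arrow E).

Lemma is_cat_det mu z z' x : is_cat mu z x -> is_cat mu z' x -> z = z'.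
Proof. by move=> /is_catP[_ ->] /is_catP[_ ->]. Qed.

Lemma is_cat_fun mu z x y : is_cat mu z x -> is_cat mu z y -> x = y.
Proof. by move=> [_ hx] [_ hy]; apply: ipath_ext => i; rewrite hx hy. Qed.

Lemma inf_path : no_sources E -> forall v : vert E, exists z, irng z = v.
Proof.
move=> ns v; have nxt (w : vert E) : {e : edge E | rng e = w} by apply/cid/ns.
pose f := fix f i := if i is j.+1 then sval (nxt (src (f j))) else sval (nxt v).
have fP i : src (f i) = rng (f i.+1) by rewrite /= (svalP (nxt _)).
by exists (IPath fP); apply: (svalP (nxt v)).
Qed.

Lemma cylinder_arrow mu nu z x y : is_cat mu z x -> is_cat nu z y ->
  exists g, [/\ cylinder mu nu g, arr_rng g = x & arr_src g = y].
Proof.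
move=> cx cy.
have ok : exists mu' nu' z', [/\ is_cat mu' z' x, is_cat nu' z' y &
    (plen mu)%:Z - (plen nu)%:Z = (plen mu')%:Z - (plen nu')%:Z].
  by exists mu, nu, z.
by exists (GraphArrow ok); split=> //; exists z.
Qed.

Lemma cylinder_over_rng mu nu z x : psrc mu = psrc nu -> is_cat mu z x ->
  exists g, cylinder mu nu g /\ arr_rng g = x.
Proof.
move=> e cx; have [|y cy] := @is_cat_ex _ nu z; first by rewrite -e; case: cx.
by have [g [cg rg _]] := cylinder_arrow cx cy; exists g.
Qed.

Lemma cylinder_over_src mu nu z y : psrc mu = psrc nu -> is_cat nu z y ->
  exists g, cylinder mu nu g /\ arr_src g = y.
Proof.
move=> e cy; have [|x cx] := @is_cat_ex _ mu z; first by rewrite e; case: cy.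
by have [g [cg _ sg]] := cylinder_arrow cx cy; exists g.
Qed.

Lemma cylinder_nonempty mu nu : no_sources E -> psrc mu = psrc nu ->
  exists g, cylinder mu nu g.
Proof.
move=> ns e; have [z ez] := inf_path ns (psrc mu); have [x cx] := is_cat_ex ez.
by have [g [cg _]] := cylinder_over_rng e cx; exists g.
Qed.

(** Cylinders whose second paths have the same length are equal or disjoint. *)
Lemma cylinder_plen_inj mu nu mu' nu' g : cylinder mu nu g -> cylinder mu' nu' g ->
  plen nu = plen nu' -> mu = mu' /\ nu = nu'.
Proof.
move=> /cylinderE[e1 e2 [ek _]] /cylinderE[e1' e2' [ek' _]] en.
have em : plen mu = plen mu' by lia.
by rewrite e1 e2 e1' e2' em en.
Qed.

Lemma cylinder_bisection_rng mu nu g h : cylinder mu nu g -> cylinder mu nu h ->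
  arr_rng g = arr_rng h -> g = h.
Proof.
move=> [z [a b c]] [z' [a' b' c']] e; rewrite e in a.
have ez := is_cat_det a a'; rewrite -ez in b'.
by apply: graph_arrow_ext => //; [rewrite c c' | exact: is_cat_fun b b'].
Qed.

Lemma arr_invK g : arr_inv (arr_inv g) = g.
Proof. by apply: graph_arrow_ext => //=; rewrite opprK. Qed.

Lemma cylinder_inv mu nu g : cylinder mu nu (arr_inv g) <-> cylinder nu mu g.
Proof.
by split=> -[z [a b c]]; exists z; split=> //; move: c => /=; lia.
Qed.

Lemma cylinder_bisection_src mu nu g h : cylinder mu nu g -> cylinder mu nu h ->
  arr_src g = arr_src h -> g = h.
Proof.
rewrite -(arr_invK g) -(arr_invK h) => /cylinder_inv cg /cylinder_inv ch e.
by rewrite (cylinder_bisection_rng cg ch e).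
Qed.

Lemma cylinder_psrc mu nu g : cylinder mu nu g -> psrc mu = psrc nu.
Proof. by move=> [z [[<- _] [<- _] _]]. Qed.

Lemma cylinder_nbhs g : exists mu nu, cylinder mu nu g.
Proof.
have [m [n l]] := arr_lag g; have [_ c] := cylinder_prefix l.
by eexists; eexists; exact: c.
Qed.

Lemma cylinder_shrink g mu nu p : cylinder mu nu g ->
  exists mu' nu', [/\ cylinder mu' nu' g, plen mu' = (plen mu + p)%N,
    plen nu' = (plen nu + p)%N & cylinder mu' nu' `<=` cylinder mu nu].
Proof.
move=> c; have /cylinderE[e1 e2 l] := c.
have [_ c'] := cylinder_prefix (lag_eqD p l).
exists (ipath_prefix (arr_rng g) (plen mu + p)), (ipath_prefix (arr_src g) (plen nu + p)).
rewrite !plen_prefix; split=> //; apply: (cylinder_sub _ c c').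
by rewrite plen_prefix leq_addr.
Qed.

Lemma cylinder_join mu nu mu' nu' g : cylinder mu nu g -> cylinder mu' nu' g ->
  exists mu2 nu2, cylinder mu2 nu2 g /\
    cylinder mu2 nu2 `<=` cylinder mu nu `&` cylinder mu' nu'.
Proof.
move=> c c'; have [||C [[m [n [_ ->]]] cg s]] := cylinders_join _ _ c c'.
- by exists mu, nu; split=> //; apply: cylinder_psrc c.
- by exists mu', nu'; split=> //; apply: cylinder_psrc c'.
by exists m, n.
Qed.

(** Cylinders that meet are nested, the one with the longer paths inside the
    other; a cylinder around [g] with long paths therefore cannot meet one that
    misses [g]. *)
Lemma cylinder_closed mu nu g : ~ cylinder mu nu g ->
  exists mu' nu', cylinder mu' nu' g /\ forall h, cylinder mu' nu' h -> ~ cylinder mu nu h.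
Proof.
move=> ng; have [m [n c]] := cylinder_nbhs g.
have [m' [n' [c' lm _ _]]] := cylinder_shrink (plen mu) c.
exists m', n'; split=> // h ch chh; apply: ng.
by apply: (cylinder_sub _ chh ch c'); rewrite lm leq_addl.
Qed.

Definition is_unit g : Prop := arr_rng g = arr_src g /\ arr_deg g = 0.

Lemma is_unitP g : is_unit g <-> exists x, g = arr_unit x.
Proof.
split=> [[e d]|[x ->]] //; exists (arr_rng g).
by apply: graph_arrow_ext.
Qed.

Lemma cylinder_unit mu x : cylinder mu mu (arr_unit x) <->
  mu = ipath_prefix x (plen mu).
Proof.
split=> [/cylinderE[]//|e]; apply/cylinderE; split=> //=.
by split=> //; rewrite subrr.
Qed.

Lemma cylinder_diag_unit mu g : cylinder mu mu g -> is_unit g.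
Proof.
move=> [z [a b c]]; split; first exact: is_cat_fun a b.
by rewrite c subrr.
Qed.

(** [mulrel h k g] is the relation [h k = g], free of the composability proof
    that the product takes. *)
Definition mulrel h k g : Prop := [/\ arr_src h = arr_rng k, arr_rng g = arr_rng h,
  arr_src g = arr_src k & arr_deg g = arr_deg h + arr_deg k].

Lemma mulrelP h k g : mulrel h k g <-> exists e : arr_src h = arr_rng k, arr_mul e = g.
Proof.
split=> [[e e1 e2 e3]|[e <-]]; last by split.
by exists e; apply: graph_arrow_ext.
Qed.

Lemma mulrel_unit g : mulrel g g g <-> is_unit g.
Proof.
by split=> [[a _ _ d]|[a d]]; split=> //; lia.
Qed.

Lemma mulrel_ldiv h g : arr_rng h = arr_rng g -> exists k, mulrel h k g.
Proof.
move=> e; have e' : arr_src (arr_inv h) = arr_rng g by [].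
by exists (arr_mul e'); split=> //=; lia.
Qed.

Lemma mulrel_injr h k k' g : mulrel h k g -> mulrel h k' g -> k = k'.
Proof.
move=> [a b c d] [a' b' c' d']; apply: graph_arrow_ext.
- by rewrite -a -a'.
- by lia.
- by rewrite -c -c'.
Qed.

Lemma mulrel_unitr h g k : is_unit k -> mulrel h k g <-> h = g /\ k = arr_unit (arr_src g).
Proof.
move=> /is_unitP[x ->]; split=> [[a b c d]|[-> ->]]; last first.
  by split=> //=; rewrite addr0.
move: a b c d => /= a b c d; split; last by rewrite c.
by apply: graph_arrow_ext => //; [lia | rewrite c].
Qed.

Lemma mulrel_inv h k x : mulrel h k (arr_unit x) <-> h = arr_inv k /\ arr_src k = x.
Proof.
split=> [[a b c d]|[-> <-]]; last by split=> //=; rewrite addNr.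
move: b c d => /= b c d; split=> //; apply: graph_arrow_ext => //=; last by lia.
by rewrite -b c.
Qed.

End Cylinders.

(** * Elements of the algebra as functions on the groupoid *)

Section Functions.
Variables (E : digraph) (R : comNzRingType).
Local Notation L := (lpa E R).
Implicit Types (a b : L) (x y z : ipath E) (mu nu : fpath E) (g h k : graph_arrow E).

(** The coefficient of [a] at [g]: the matrix entry of the action of [a] at the
    endpoints of [g]. *)
Definition rho a g : R :=
  act a (fun x l => (`[< x = arr_src g >] && (l == 0))%:R) (arr_rng g) (arr_deg g).

Lemma rhoD a b g : rho (a + b) g = rho a g + rho b g.
Proof. exact: actD. Qed.

Lemma rhoZ c a g : rho (c *: a) g = c * rho a g.
Proof. exact: actZ. Qed.

Lemma rho0 g : rho 0 g = 0.
Proof. exact: act0. Qed.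

Lemma rhoB a b g : rho (a - b) g = rho a g - rho b g.
Proof. by rewrite rhoD -scaleN1r rhoZ mulN1r. Qed.

Lemma rho_sum (I : Type) (r : seq I) (F : I -> L) g :
  rho (\sum_(i <- r) F i) g = \sum_(i <- r) rho (F i) g.
Proof. by apply: (big_morph (rho^~ g)); [move=> *; apply: rhoD | apply: rho0]. Qed.

Lemma rho_mono mu nu g : psrc mu = psrc nu ->
  rho (mono R mu nu) g = (`[< cylinder mu nu g >])%:R.
Proof.
move=> e; rewrite /rho.
have [[z hz]|nz] := pselect (exists z, is_cat mu z (arr_rng g)); last first.
  rewrite act_mono0 //; last by move=> z hz; apply: nz; exists z.
  by case: asboolP => // -[z [hz _ _]]; case: nz; exists z.
have [y hy] : exists y, is_cat nu z y by apply: is_cat_ex; rewrite -e; case: hz.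
rewrite (act_mono1 _ _ e hz hy); congr (_%:R); congr nat_of_bool.
apply/andP/asboolP => [[/asboolP ey /eqP ek]|[z' [h1 h2 ek]]].
  by exists z; split=> //; [rewrite -ey | lia].
rewrite (is_cat_det h1 hz) in h2; split; first by apply/asboolP/(is_cat_fun hy h2).
by apply/eqP; lia.
Qed.

Lemma rho_monoP mu nu g : psrc mu = psrc nu ->
  reflect (cylinder mu nu g) (rho (mono R mu nu) g != 0).
Proof.
move=> e; rewrite rho_mono //; case: asboolP => c.
  by rewrite oner_eq0; constructor.
by rewrite eqxx; constructor.
Qed.

(** A cylinder contains at most one arrow with a given range. *)
Lemma rho_row_finite a x : finite_set [set h | arr_rng h = x /\ rho a h != 0].
Proof.
elim/lpa_ind: a => [|a b ha hb|c a ha|mu nu e].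
- apply: (sub_finite_set (B := set0)) => // h [_]; by rewrite rho0 eqxx.
- apply: (sub_finite_set (B := [set h | arr_rng h = x /\ rho a h != 0] `|`
     [set h | arr_rng h = x /\ rho b h != 0])); last by rewrite finite_setU.
  move=> h [eh]; rewrite rhoD; have [->|na _] := eqVneq (rho a h) 0.
    by rewrite add0r => nb; right.
  by left.
- apply: sub_finite_set ha => h [eh]; rewrite rhoZ => n; split=> //.
  by apply: contra_neq n => ->; rewrite mulr0.
- have [[g [eg cg]]|ng] := pselect (exists g, arr_rng g = x /\ cylinder mu nu g).
    apply: (sub_finite_set (B := [set g])) => // h [eh /(rho_monoP _ e) ch].
    by apply: (cylinder_bisection_rng ch cg); rewrite eg.
  apply: (sub_finite_set (B := set0)) => // h [eh /(rho_monoP _ e) ch].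
  by case: ng; exists h.
Qed.

Definition locally_constant (T : Type) (u : graph_arrow E -> T) : Prop :=
  forall g, exists mu nu, cylinder mu nu g /\ forall h, cylinder mu nu h -> u h = u g.

Lemma rho_locally_constant a : locally_constant (rho a).
Proof.
move=> g; elim/lpa_ind: a => [|a b [m [n [c ha]]] [m' [n' [c' hb]]]|c a [m [n [ca ha]]]|mu nu e].
- by have [m [n c]] := cylinder_nbhs g; exists m, n; split=> // h _; rewrite !rho0.
- have [m2 [n2 [c2 s]]] := cylinder_join c c'.
  by exists m2, n2; split=> // h /s[/ha e1 /hb e2]; rewrite !rhoD e1 e2.
- by exists m, n; split=> // h /ha; rewrite !rhoZ => ->.
- have [c|nc] := pselect (cylinder mu nu g).
    by exists mu, nu; split=> // h ch; rewrite !rho_mono //; do !case: asboolP.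
  have [m [n [c hc]]] := cylinder_closed nc.
  exists m, n; split=> // h /hc ch.
  by rewrite !rho_mono //; do !case: asboolP.
Qed.

Hypotheses (rfE : row_finite E) (nsE : no_sources E).

(** Collect the terms with the same pair of paths as the first one; the cylinders
    of the remaining pairs are disjoint from its cylinder, so at any of its arrows
    the element takes the collected coefficient as value. *)
Lemma leveled_reconstruct N (P : seq (R * (fpath E * fpath E))) :
  balanced P -> (forall i, List.In i P -> plen i.2.2 = N) ->
  exists Q, [/\ balanced Q,
    (forall i, List.In i Q -> exists2 j, List.In j P & j.2 = i.2),
    (forall i, List.In i Q -> exists g, cylinder i.2.1 i.2.2 g /\
        rho (\sum_(i <- P) term_eval i) g != 0) &
    \sum_(i <- P) term_eval i = \sum_(i <- Q) term_eval i].
Proof.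
have [n] := ubnP (size P); elim: n => // n IH in P *.
case: P => [|i0 P0]; first by exists [::]; split=> // i [].
set P := i0 :: P0 => sP bP lP; pose q := i0.2.
pose P2 := [seq j <- P | ~~ `[< j.2 = q >]].
have inP2 j : List.In j P2 -> List.In j P /\ j.2 <> q.
  rewrite /P2; elim: (P) => //= k r IHr; case: asboolP => /= [_ /IHr[? ?]|nk].
    by split=> //; right.
  by move=> [<-|/IHr[? ?]]; split=> //; [left | right].
have sP2 : (size P2 < n)%N.
  rewrite /P2 /P /=; case: asboolP => //= _; apply: (@leq_ltn_trans (size P0)) => //.
  by rewrite size_filter count_size.
have [||Q2 [bQ2 sQ2 nQ2 eQ2]] := IH P2 sP2.
- by move=> j /inP2[/bP].
- by move=> j /inP2[/lP].
pose c := \sum_(j <- P | `[< j.2 = q >]) j.1.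
have eP : \sum_(i <- P) term_eval i = c *: mono R q.1 q.2 + \sum_(i <- P2) term_eval i.
  rewrite (bigID (fun j => `[< j.2 = q >])) /= big_filter; congr (_ + _).
  by rewrite scaler_suml; apply: eq_bigr => j /asboolP ej; rewrite /term_eval ej.
have bq : psrc q.1 = psrc q.2 by apply: bP; left.
have lq : plen q.2 = N by apply: (lP i0); left.
have disj j g : List.In j P -> j.2 <> q -> cylinder j.2.1 j.2.2 g ->
    cylinder q.1 q.2 g -> False.
  move=> jP nj cj cq; apply: nj.
  have [|e1 e2] := cylinder_plen_inj cj cq; first by rewrite (lP j jP) lq.
  by rewrite (surjective_pairing j.2) e1 e2 -surjective_pairing.
have [c0|nc] := eqVneq c 0.
  rewrite eP c0 scale0r add0r; exists Q2; split=> // j /sQ2[k /inP2[kP _] ek].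
  by exists k.
exists ((c, q) :: Q2); rewrite eP big_cons -eQ2; split=> //.
- by apply/balanced_cons.
- move=> j [<-|/sQ2[k /inP2[kP _] ek]]; last by exists k.
  by exists i0 => //; left.
- move=> j [<-|jQ2] /=.
    have [g cg] := cylinder_nonempty nsE bq; exists g; split=> //.
    rewrite rhoD rhoZ rho_mono //; case: asboolP => // _; rewrite mulr1 rho_sum.
    have -> : \sum_(i <- P2) rho (term_eval i) g = 0.
      have : forall j, List.In j P2 -> rho (term_eval j) g = 0.
        move=> k /inP2[kP nk]; rewrite rhoZ rho_mono; last exact: bP.
        by case: asboolP; rewrite ?mulr0 // => ck; case: (disj k g).
      elim: (P2) => [|k r IHr] hk; first by rewrite big_nil.
      rewrite big_cons hk ?IHr ?addr0 //; last by left.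
      by move=> k' hk'; apply: hk; right.
    by rewrite addr0.
  have [g [cg ng]] := nQ2 _ jQ2; exists g; split=> //.
  rewrite rhoD rhoZ rho_mono //; case: asboolP; last by rewrite mulr0 add0r.
  have [k /inP2[kP nk] ek] := sQ2 _ jQ2.
  by rewrite -ek in cg; move=> cq; case: (disj k g).
Qed.

(** Expanding all monomials to the same length makes their cylinders pairwise
    disjoint, so that each coefficient is a value of [rho a]. *)
Lemma lpa_reconstruct a : exists Q, [/\ balanced Q,
    (forall i, List.In i Q -> exists g, cylinder i.2.1 i.2.2 g /\ rho a g != 0) &
    a = \sum_(i <- Q) term_eval i].
Proof.
have [N /(_ _ (leqnn N))[P [bP lP ->]]] := lpa_leveled rfE a.
have [Q [bQ _ nQ eQ]] := leveled_reconstruct bP lP.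
by exists Q; rewrite -eQ.
Qed.

Lemma rho_inj a b : (forall g, rho a g = rho b g) -> a = b.
Proof.
move=> e; apply/eqP; rewrite -subr_eq0; apply/eqP.
have [[|i Q] [_ hQ ->]] := lpa_reconstruct (a - b); first by rewrite big_nil.
have [|g [_]] := hQ i; first by left.
by rewrite rhoB e subrr eqxx.
Qed.

(** A cylinder that contains a unit belongs to a pair [(mu, mu)], so that when
    [rho a] is supported on units all terms of a reconstruction are of this
    kind. *)
Lemma lpa_diagP a : lpa_diag E R a <-> forall g, rho a g != 0 -> is_unit g.
Proof.
split=> [[n [c [mu ->]]] g|h].
  rewrite rho_sum; apply: contra_neqP => nu; apply: big1 => i _.
  rewrite rhoZ rho_mono //; case: asboolP; rewrite ?mulr0 //.
  by move=> /cylinder_diag_unit.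
have [Q [bQ hQ ->]] := lpa_reconstruct a.
have hQ' i : List.In i Q -> i.2.1 = i.2.2.
  move=> /hQ[g [/cylinderE[e1 e2 [ek _]] /h[eg dg]]].
  by rewrite e1 e2 eg; congr (ipath_prefix _ _); lia.
have -> : \sum_(i <- Q) term_eval i = \sum_(i <- Q) i.1 *: mono R i.2.1 i.2.1.
  elim: (Q) hQ' => [|i r IHr] hr; first by rewrite !big_nil.
  rewrite !big_cons IHr /term_eval ?hr //; first by left.
  by move=> j hj; apply: hr; right.
by rewrite big_tnth; exists (size Q), (fun i => (tnth (in_tuple Q) i).1),
  (fun i => (tnth (in_tuple Q) i).2.1).
Qed.

End Functions.

Arguments rho_monoP {E R mu nu g}.

(** * Convolution *)

Section Convolution.
Variables (E : digraph) (R : idomainType).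
Local Notation L := (lpa E R).
Implicit Types (a b : L) (u v : graph_arrow E -> R) (mu nu : fpath E)
  (g h k : graph_arrow E).

(** The sum runs over all factorizations [g = h k]; only finitely many of them
    contribute when [u] has finite support over each range. *)
Definition conv u v g : R :=
  \sum_(q \in [set q : graph_arrow E * graph_arrow E | mulrel q.1 q.2 g]) u q.1 * v q.2.

Lemma conv_neq0 u v g : conv u v g != 0 ->
  exists h k, [/\ mulrel h k g, u h != 0 & v k != 0].
Proof.
move=> nz; apply: contrapT => no; move/eqP: nz; apply; apply: fsbig1 => -[h k] /= m.
have [->|uh] := eqVneq (u h) 0; first by rewrite mul0r.
have [->|vk] := eqVneq (v k) 0; first by rewrite mulr0.
by case: no; exists h, k.
Qed.

Lemma conv_single u v g h k : mulrel h k g ->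
  (forall h' k', mulrel h' k' g -> u h' != 0 -> v k' != 0 -> h' = h) ->
  conv u v g = u h * v k.
Proof.
move=> m uniq; rewrite /conv.
rewrite -(@fsbig_widen _ _ _ _ [set (h, k)]); first by rewrite fsbig_set1.
  by move=> q ->.
move=> [h' k'] /= [m' ne].
have [->|uh] := eqVneq (u h') 0; first by rewrite mul0r.
have [->|vk] := eqVneq (v k') 0; first by rewrite mulr0.
by case: ne; have eh := uniq _ _ m' uh vk; rewrite eh (mulrel_injr m (_ : mulrel h k' g)) // -eh.
Qed.

Definition row_finite_fun u : Prop :=
  forall x, finite_set [set h | arr_rng h = x /\ u h != 0].

Lemma convD u u' v g : row_finite_fun u -> row_finite_fun u' ->
  conv (fun h => u h + u' h) v g = conv u v g + conv u' v g.
Proof.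
move=> fu fu'; pose A := [set q : graph_arrow E * graph_arrow E | mulrel q.1 q.2 g].
pose T := [set h | arr_rng h = arr_rng g /\ u h != 0] `|`
  [set h | arr_rng h = arr_rng g /\ u' h != 0].
have fT : finite_set T by rewrite finite_setU.
pose S := A `&` [set q | T q.1].
(* A factorization of g is determined by its left factor: k = d h. *)
have [d hd] : exists d : graph_arrow E -> graph_arrow E,
    forall h, arr_rng h = arr_rng g -> mulrel h (d h) g.
  have /choice[d hd] h : exists k, arr_rng h = arr_rng g -> mulrel h k g.
    have [e|ne] := pselect (arr_rng h = arr_rng g); last by exists h.
    by have [k hk] := mulrel_ldiv e; exists k.
  by exists d.
have fS : finite_set S.
  apply: (sub_finite_set (B := (fun h => (h, d h)) @` T)); last exact: finite_image.
  move=> [h k] [/= m Th]; exists h => //; congr (_, _).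
  by apply: (mulrel_injr _ m); apply: hd; case: m.
have wid w : (forall h, w h != 0 -> u h != 0 \/ u' h != 0) ->
    conv w v g = \sum_(q \in S) w q.1 * v q.2.
  move=> hw; symmetry; apply: fsbig_widen; first exact: subIsetl.
  move=> [h k] [m nS] /=; have [->|/hw wh] := eqVneq (w h) 0; first by rewrite mul0r.
  by case: nS; split=> //=; case: (m) => /= _ e _ _; case: wh; [left | right].
rewrite (wid (fun h => u h + u' h)); last first.
  move=> h; have [->|] := eqVneq (u h) 0; last by left.
  by rewrite add0r => ?; right.
rewrite (wid u) 1?(wid u'); try by [move=> h; left | move=> h; right].
rewrite -fsbig_split //; apply: eq_fsbigr => q _; exact: mulrDl.
Qed.

Lemma convZ c u v g : conv (fun h => c * u h) v g = c * conv u v g.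
Proof. by rewrite /conv mulr_fsumr; under eq_fsbigr do rewrite -mulrA. Qed.

(** For a monomial [a] at most one arrow of its cylinder has the range of [g], so
    that the convolution has a single term, which is the action of [a]. *)
Lemma rhoM a b g : rho (lpa_mul a b) g = conv (rho a) (rho b) g.
Proof.
have aA := lpa_algebra E R.
elim/lpa_ind: a => [|a a' ha ha'|c a ha|mu nu e].
- rewrite lpa_mul0l rho0; symmetry; apply: fsbig1 => q _.
  by rewrite rho0 mul0r.
- rewrite (alg_mulDl aA) rhoD ha ha' -convD; try exact: rho_row_finite.
  by congr (conv _ _ g); apply/funext => h; rewrite rhoD.
- rewrite (alg_scalel aA) rhoZ ha -convZ.
  by congr (conv _ _ g); apply/funext => h; rewrite rhoZ.
have [[h [ch eh]]|nh] := pselect (exists h, cylinder mu nu h /\ arr_rng h = arr_rng g).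
  have [k m] := mulrel_ldiv eh.
  rewrite (conv_single m); last first.
    move=> h' k' m' /(rho_monoP e) ch' _.
    by apply: (cylinder_bisection_rng ch' ch); rewrite eh; case: m'.
  rewrite rho_mono //; case: asboolP => // _; rewrite mul1r.
  have [z [cx cy ek]] := ch; rewrite eh in cx.
  rewrite /rho actM (act_mono1 _ _ e cx cy).
  have [-> _ -> dk] := m; congr (act b _ _ _); lia.
rewrite /rho actM act_mono0 //; last first.
  by move=> z /(cylinder_over_rng e)[h hh]; apply: nh; exists h.
symmetry; apply: fsbig1 => -[h k] /= [_ eg _ _].
rewrite -/(rho _ _) rho_mono //; case: asboolP; rewrite ?mul0r // => ch.
by case: nh; exists h.
Qed.

Lemma rho_star (conj : {rmorphism R -> R}) a g :
  rho (lpa_star conj a) g = conj (rho a (arr_inv g)).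
Proof.
elim/lpa_ind: a => [|a b ha hb|c a ha|mu nu e].
- by rewrite lpa_star0 !rho0 rmorph0.
- by rewrite lpa_starD !rhoD ha hb rmorphD.
- by rewrite lpa_starZ !rhoZ ha rmorphM.
- have := lpa_star_monomial conj 1 mu nu.
  rewrite rmorph1 !scale1r -!/(mono _ _ _) => ->.
  rewrite !rho_mono // rmorph_nat; congr (nat_of_bool _)%:R.
  by apply: asbool_equiv_eq; split=> /cylinder_inv; rewrite ?arr_invK.
Qed.

End Convolution.

(** * Bar induction on infinite paths *)

Section Bar.
Variable E : digraph.

Lemma is_path_rcons (v : vert E) l e :
  is_path v (rcons l e) = is_path v l && (rng e == last v (map (@src E) l)).
Proof. by elim: l v => [|f l IH] v /=; rewrite ?andbT // IH andbA. Qed.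

(** If [P] propagates from all one-edge extensions of a path to the path, and
    holds at some initial segment of each infinite path, then it holds at the
    empty path: otherwise dependent choice would produce an infinite path all
    of whose initial segments violate [P].  Applied to row-finite graphs, this
    is the compactness of the cylinders. *)
Lemma bar_induction (v : vert E) (P : seq (edge E) -> Prop) :
  (forall l, is_path v l -> (forall e, is_path v (rcons l e) -> P (rcons l e)) -> P l) ->
  (forall z : ipath E, irng z = v -> exists n, P (pedges (ipath_prefix z n))) ->
  P [::].
Proof.
move=> step bar; apply: contrapT => nP0.
pose T := {l | is_path v l /\ ~ P l}.
have nxt (l : T) : {e | is_path v (rcons (sval l) e) /\ ~ P (rcons (sval l) e)}.
  apply: cid; case: l => l [pl nPl] /=; apply: contrapT => no; apply: nPl.
  by apply: step => // e pe; apply: contrapT => nPe; apply: no; exists e.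
pose t0 : T := exist _ [::] (conj isT nP0).
pose t := fix t n : T := if n is m.+1
  then exist _ (rcons (sval (t m)) (sval (nxt (t m)))) (svalP (nxt (t m))) else t0.
pose z n := sval (nxt (t n)).
have tz n : sval (t n) = [seq z i | i <- iota 0 n].
  elim: n => [//|n IH]; rewrite -[in RHS]addn1 iotaD map_cat /= cats1 -IH.
  by rewrite add0n.
have zP i : src (z i) = rng (z i.+1).
  have [+ _] := svalP (nxt (t i.+1)); rewrite is_path_rcons => /andP[_ /eqP].
  by rewrite -/(z i.+1) => ->; rewrite /= map_rcons last_rcons.
have z0 : rng (z 0%N) = v.
  by have [+ _] := svalP (nxt (t 0%N)) => /= /andP[/eqP].
have [n] := bar (IPath zP) z0.
by rewrite /= -tz; have [] := svalP (t n).
Qed.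

End Bar.

(** The junk value is [mu] itself, when the edges do not continue it. *)
Definition pext (E : digraph) (mu : fpath E) (l : seq (edge E)) : fpath E :=
  match pselect (is_path (prng mu) (pedges mu ++ l)) with
  | left h => FPath h
  | right _ => mu
  end.

Section Extension.
Variable E : digraph.
Implicit Types (mu nu : fpath E) (l : seq (edge E)).

Lemma is_path_cat v (l l' : seq (edge E)) :
  is_path v (l ++ l') = is_path v l && is_path (last v (map (@src E) l)) l'.
Proof. by elim: l v => [|e l IH] v //=; rewrite IH andbA. Qed.

Lemma pext_spec mu l : is_path (psrc mu) l ->
  prng (pext mu l) = prng mu /\ pedges (pext mu l) = pedges mu ++ l.
Proof.
by move=> h; rewrite /pext; case: pselect => //; rewrite is_path_cat pathP h.
Qed.

Lemma psrc_pext mu l : is_path (psrc mu) l ->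
  psrc (pext mu l) = last (psrc mu) (map (@src E) l).
Proof. by move=> /pext_spec[e1 e2]; rewrite /psrc e1 e2 map_cat last_cat. Qed.

Lemma plen_pext mu l : is_path (psrc mu) l -> plen (pext mu l) = (plen mu + size l)%N.
Proof. by move=> /pext_spec[_ e2]; rewrite /plen e2 size_cat. Qed.

Lemma is_cat_pext mu l z x : is_path (psrc mu) l ->
  is_cat (pext mu l) z x <-> exists y, is_cat mu y x /\
    l = pedges (ipath_prefix y (size l)) /\ z = ipath_shift (size l) y.
Proof.
move=> h; rewrite is_catP plen_pext //; have [e1 e2] := pext_spec h; split.
  move=> [e ez]; exists (ipath_shift (plen mu) x); rewrite is_catP.
  have ee : pedges mu ++ l = pedges (ipath_prefix x (plen mu + size l)) by rewrite -e e2.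
  move: ee; rewrite /= iotaD map_cat => /eqP; rewrite eqseq_cat; last first.
    by rewrite size_map size_iota.
  move=> /andP[/eqP emu /eqP el]; split; last split.
  - split=> //; apply: fpath_ext => //; rewrite -e1 e //.
  - rewrite {1}el add0n -[in LHS](addn0 (plen mu)) iotaDl -map_comp.
    by apply: eq_map.
  - by rewrite ez; apply: ipath_ext => i /=; rewrite addnA.
move=> [y [/is_catP[emu ey] [el ez]]]; split; last first.
  by rewrite ez ey; apply: ipath_ext => i /=; rewrite addnA.
apply: fpath_ext; first by rewrite e1 emu.
rewrite e2 /= iotaD map_cat; congr (_ ++ _); first by rewrite {1}emu.
rewrite {1}el ey /= add0n -[in RHS](addn0 (plen mu)) iotaDl -map_comp.
by apply: eq_map.
Qed.

Lemma cylinder_pext mu nu l g : psrc mu = psrc nu -> is_path (psrc mu) l ->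
  cylinder (pext mu l) (pext nu l) g <-> exists z,
    [/\ is_cat mu z (arr_rng g), is_cat nu z (arr_src g),
        arr_deg g = (plen mu)%:Z - (plen nu)%:Z & l = pedges (ipath_prefix z (size l))].
Proof.
move=> e h; have h' : is_path (psrc nu) l by rewrite -e.
split=> [[z [/(is_cat_pext _ _ h)[y [cy [el ez]]] /(is_cat_pext _ _ h')[y' [cy' [el' ez']]]]]|].
  rewrite !plen_pext // => ek.
  have eyy : y = y'.
    apply: ipath_ext => i; have [hi|hi] := ltnP i (size l).
      apply: (prefix_eq hi); apply: fpath_ext; last by rewrite -el.
      exact: etrans cy.1 (etrans e (esym cy'.1)).
    rewrite -(subnKC hi).
    exact: (congr1 (fun t : ipath E => t (i - size l)%N) (etrans (esym ez) ez')).
  by exists y; rewrite {2}eyy; split=> //; lia.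
move=> [y [cy cy' ek el]]; exists (ipath_shift (size l) y); rewrite !plen_pext //.
split; [by apply/is_cat_pext => //; exists y | by apply/is_cat_pext => //; exists y | lia].
Qed.

(** Bar induction along the infinite paths [z] that continue both [mu] and [nu];
    the arrows of the cylinder are the pairs of paths [mu z], [nu z]. *)
Lemma cylinder_bar (P : fpath E -> fpath E -> Prop) mu nu : psrc mu = psrc nu ->
  (forall mu' nu', psrc mu' = psrc nu' ->
     (forall e, rng e = psrc mu' -> P (pext mu' [:: e]) (pext nu' [:: e])) -> P mu' nu') ->
  (forall g, cylinder mu nu g -> exists m n, cylinder m n g /\
     forall m' n', cylinder m' n' `<=` cylinder m n -> P m' n') ->
  P mu nu.
Proof.
move=> e step bar.
have ext0 (m : fpath E) : pext m [::] = m.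
  by have [e1 e2] := @pext_spec m [::] isT; apply: fpath_ext; rewrite // e2 cats0.
rewrite -[mu]ext0 -[nu]ext0.
apply: (@bar_induction E (psrc mu) (fun l => P (pext mu l) (pext nu l))).
  move=> l hl hP; have hl' : is_path (psrc nu) l by rewrite -e.
  apply: step => [|f]; first by rewrite !psrc_pext // e.
  rewrite psrc_pext // => hf.
  have hlf : is_path (psrc mu) (rcons l f) by rewrite is_path_rcons hl hf eqxx.
  have hf1 : is_path (psrc (pext mu l)) [:: f] by rewrite /= psrc_pext // hf eqxx.
  have hf2 : is_path (psrc (pext nu l)) [:: f] by rewrite /= psrc_pext // -e hf eqxx.
  have ext1 (m : fpath E) : is_path (psrc m) (rcons l f) -> is_path (psrc m) l ->
      is_path (psrc (pext m l)) [:: f] -> pext (pext m l) [:: f] = pext m (rcons l f).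
    move=> h1 h2 h3; apply: fpath_ext.
      by rewrite (pext_spec h3).1 (pext_spec h2).1 (pext_spec h1).1.
    by rewrite (pext_spec h3).2 (pext_spec h2).2 (pext_spec h1).2 -catA cats1.
  by rewrite !ext1 //; [apply: hP | rewrite -e].
move=> z ez; have [x cx] := is_cat_ex ez; have [y cy] := is_cat_ex (etrans ez e).
have [g [cg rg sg]] := cylinder_arrow cx cy.
have [m [n [cmn hP]]] := bar g cg.
(* Extending mu and nu along z by the length of m makes the first path at least
   as long as m, and then the cylinder lies inside that of m and n. *)
exists (plen m); apply: hP.
set l := pedges _.
have sl : size l = plen m by rewrite /l size_map size_iota.
have hl : is_path (psrc mu) l by rewrite -ez; apply: pathP.
apply: (cylinder_sub _ cmn); first by rewrite plen_pext // sl leq_addl.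
apply/cylinder_pext => //; exists z; rewrite rg sg sl; split=> //.
by have [? [_ _ ->]] := cg.
Qed.

End Extension.

(** * From groupoid isomorphisms to algebra isomorphisms *)

Section Image.
Variables (E F : digraph) (R : idomainType).
Hypothesis rfE : row_finite E.

Definition in_image (u : graph_arrow F -> R) : Prop := exists b : lpa F R, rho b = u.

Lemma in_image0 : in_image (fun=> 0).
Proof. by exists 0; apply/funext => h; apply: rho0. Qed.

(** The one-edge extensions partition the cylinder, so at most one summand
    survives. *)
Lemma cylinder_split (mu nu : fpath E) (r : seq (edge E)) g (c : R) :
  psrc mu = psrc nu -> uniq r -> (forall e, (e \in r) = (rng e == psrc mu)) ->
  \sum_(e <- r) (if `[< cylinder (pext mu [:: e]) (pext nu [:: e]) g >] then c else 0)
  = if `[< cylinder mu nu g >] then c else 0.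
Proof.
move=> e ur hr.
have extP f : f \in r -> cylinder (pext mu [:: f]) (pext nu [:: f]) g <-> exists z,
    [/\ is_cat mu z (arr_rng g), is_cat nu z (arr_src g),
        arr_deg g = (plen mu)%:Z - (plen nu)%:Z & f = z 0%N].
  rewrite hr => hf; rewrite cylinder_pext //=; last by rewrite hf.
  by split=> -[z [a b d]] => [[->]|->]; exists z.
case: asboolP => [[z [a b d]]|nc]; last first.
  rewrite big_seq big1 // => f /extP fP; case: asboolP => // /fP[z [a b d _]].
  by case: nc; exists z.
have zr : z 0%N \in r by rewrite hr; apply/eqP; case: a.
rewrite (bigD1_seq _ zr ur) /=; case: asboolP => [_|]; last first.
  by case; apply/(extP _ zr); exists z.
rewrite big_seq_cond big1 ?addr0 // => f /andP[/extP fP fz].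
by case: asboolP => // /fP[z' [a' _ _ ef]]; rewrite ef (is_cat_det a' a) eqxx in fz.
Qed.

Lemma in_image_split (chi : graph_arrow F -> graph_arrow E)
    (u : graph_arrow F -> R) (mu nu : fpath E) : psrc mu = psrc nu ->
  (forall e, rng e = psrc mu ->
    in_image (fun h => if `[< cylinder (pext mu [:: e]) (pext nu [:: e]) (chi h) >]
                       then u h else 0)) ->
  in_image (fun h => if `[< cylinder mu nu (chi h) >] then u h else 0).
Proof.
move=> e hP; have [r [ur hr]] := row_enum rfE (psrc mu).
have /choice[b hb] : forall f, exists b, f \in r -> rho b = (fun h =>
    if `[< cylinder (pext mu [:: f]) (pext nu [:: f]) (chi h) >] then u h else 0).
  move=> f; have [|nf] := boolP (f \in r); last by exists 0.
  by rewrite hr => /eqP /hP[b hb]; exists b.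
exists (\sum_(f <- r) b f); apply/funext => h; rewrite rho_sum.
rewrite -(cylinder_split _ _ e ur hr) big_seq [RHS]big_seq.
by apply: eq_bigr => f /hb ->.
Qed.

End Image.

(** By bar induction: near each arrow the function is a multiple of the indicator
    of a cylinder, and finite branching lets such pieces be added up. *)
Lemma locally_constant_in_image (F : digraph) (R : idomainType) (rfF : row_finite F)
    (u : graph_arrow F -> R) (mu nu : fpath F) :
  locally_constant u -> (forall h, u h != 0 -> cylinder mu nu h) -> in_image u.
Proof.
move=> lu su.
have [e|ne] := pselect (psrc mu = psrc nu); last first.
  rewrite (_ : u = fun=> 0); first exact: in_image0.
  apply/funext => h; apply: contra_notP ne => /eqP/su; exact: cylinder_psrc.
have -> : u = fun h => if `[< cylinder mu nu h >] then u h else 0.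
  apply/funext => h; case: asboolP => // nc.
  by apply: contra_notP nc => /eqP/su.
apply: (@cylinder_bar F (fun m n => in_image (fun h =>
    if `[< cylinder m n h >] then u h else 0)) mu nu e).
  by move=> m n emn; apply: (in_image_split rfF (chi := id)).
move=> g _; have [m [n [cg hu]]] := lu g; exists m, n; split=> // m' n' sub.
have [e'|ne] := pselect (psrc m' = psrc n'); last first.
  rewrite (_ : (fun h => _) = fun=> 0); first exact: in_image0.
  by apply/funext => h; case: asboolP => // /cylinder_psrc.
exists (u g *: mono R m' n'); apply/funext => h.
rewrite rhoZ rho_mono //; case: asboolP => [/sub/hu ->|_]; first by rewrite mulr1.
by rewrite mulr0.
Qed.

Definition cylinder_continuous (E F : digraph) (phi : graph_arrow E -> graph_arrow F) :=
  forall g m n, cylinder m n (phi g) -> exists mu nu, cylinder mu nu g /\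
    forall h, cylinder mu nu h -> cylinder m n (phi h).

Lemma continuous_cylinder (E F : digraph) (phi : graph_arrow E -> graph_arrow F) :
  continuous phi <-> cylinder_continuous phi.
Proof.
split=> [c g m n cmn|c g U /nbhs_cylinder[A [[m [n [_ ->]]] Ag sA]]].
  have /c/nbhs_cylinder[A [[mu [nu [_ ->]]] Ag sA]] : nbhs (phi g) (cylinder m n).
    apply/nbhs_cylinder; exists (cylinder m n); split=> //; exists m, n; split=> //.
    exact: cylinder_psrc cmn.
  by exists mu, nu; split=> // h /sA.
have [mu [nu [cg hc]]] := c _ _ _ Ag; apply/nbhs_cylinder.
exists (cylinder mu nu); split=> //; last by move=> h /hc/sA.
by exists mu, nu; split=> //; apply: cylinder_psrc cg.
Qed.

Definition mul_hom (E F : digraph) (phi : graph_arrow E -> graph_arrow F) :=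
  forall h k g, mulrel h k g -> mulrel (phi h) (phi k) (phi g).

Lemma groupoid_hom_mul (E F : digraph) (phi : graph_arrow E -> graph_arrow F) :
  @groupoid_hom (graph_groupoid E) (graph_groupoid F) phi <-> mul_hom phi.
Proof.
split=> [hom h k g /mulrelP[e <-]|hom h k e].
  by apply/mulrelP; have [e' ->] := hom h k e; exists e'.
have /hom/mulrelP[e' em] : mulrel h k (arr_mul e) by apply/mulrelP; exists e.
by exists e'.
Qed.

Section Transport.
Variables (E F : digraph) (R : idomainType).
Hypotheses (rfE : row_finite E) (rfF : row_finite F).
Variables (phi : graph_arrow E -> graph_arrow F) (psi : graph_arrow F -> graph_arrow E).
Hypotheses (phiK : cancel phi psi) (psiK : cancel psi phi).
Hypotheses (phiM : mul_hom phi) (psiM : mul_hom psi).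
Hypotheses (phiC : cylinder_continuous phi) (psiC : cylinder_continuous psi).

(** Near each arrow, [phi] maps a small cylinder into a single cylinder, where its
    image has a locally constant indicator. *)
Lemma transport_cylinder (mu nu : fpath E) : psrc mu = psrc nu ->
  in_image (fun h : graph_arrow F => (`[< cylinder mu nu (psi h) >])%:R : R).
Proof.
move=> e; have ind m n : (fun h : graph_arrow F => (`[< cylinder m n (psi h) >])%:R : R) =
    fun h => if `[< cylinder m n (psi h) >] then 1 else 0.
  by apply/funext => h; case: asboolP.
apply: (@cylinder_bar E (fun m n => in_image (fun h : graph_arrow F =>
   (`[< cylinder m n (psi h) >])%:R : R)) mu nu e).
  move=> m n emn hP; rewrite ind; apply: (in_image_split rfE) => // f hf.
  by rewrite -ind; apply: hP.
move=> g _; have [m [n cmn]] := cylinder_nbhs (phi g).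
have [mu' [nu' [cg hc]]] := phiC cmn.
exists mu', nu'; split=> // m' n' sub.
apply: (locally_constant_in_image rfF (mu := m) (nu := n)); last first.
  by move=> h; case: asboolP; rewrite ?eqxx // => /sub/hc; rewrite psiK.
move=> h; have [c|nc] := pselect (cylinder m' n' (psi h)).
  have [a [b [cab hab]]] := psiC c; exists a, b; split=> // k /hab.
  by do 2!case: asboolP.
have [a [b [cab hab]]] := cylinder_closed nc.
have [a' [b' [cab' hab']]] := psiC cab.
exists a', b'; split=> // k /hab'/hab.
by do 2!case: asboolP.
Qed.

Lemma transport_in_image (a : lpa E R) : in_image (rho a \o psi).
Proof.
elim/lpa_ind: a => [|a b [a' ha] [b' hb]|c a [a' ha]|mu nu e].
- by exists 0; apply/funext => h /=; rewrite !rho0.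
- by exists (a' + b'); apply/funext => h /=; rewrite !rhoD ha hb.
- by exists (c *: a'); apply/funext => h /=; rewrite !rhoZ ha.
- have [b hb] := transport_cylinder e; exists b; rewrite hb.
  by apply/funext => h /=; rewrite rho_mono.
Qed.

Lemma conv_transport (u v : graph_arrow E -> R) h :
  conv (u \o psi) (v \o psi) h = conv u v (psi h).
Proof.
rewrite /conv (@reindex_fsbig _ _ _ _ _
  (fun q : graph_arrow F * graph_arrow F => (psi q.1, psi q.2))
  [set q | mulrel q.1 q.2 h]) //.
split.
- by move=> [k l] /= /psiM.
- move=> [k l] [k' l'] _ _ /= [ek el].
  by rewrite -(psiK k) -(psiK l) ek el !psiK.
- move=> [k l] /= /phiM; rewrite psiK => m.
  by exists (phi k, phi l) => //=; rewrite !phiK.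
Qed.

Lemma unit_transport h : is_unit (psi h) <-> is_unit h.
Proof.
split=> /mulrel_unit; last by move=> /psiM/mulrel_unit.
by move=> /phiM; rewrite psiK => /mulrel_unit.
Qed.

Lemma inv_transport h : psi (arr_inv h) = arr_inv (psi h).
Proof.
have /psiM : mulrel (arr_inv h) h (arr_unit (arr_src h)) by apply/mulrel_inv.
have /unit_transport/is_unitP[x ->] : is_unit (arr_unit (arr_src h)) by [].
by move=> /mulrel_inv[].
Qed.

End Transport.

Lemma iso_of_groupoid_iso (E F : digraph) (R : idomainType)
    (conj : {rmorphism R -> R}) :
  row_finite E -> no_sources E -> row_finite F -> no_sources F ->
  topGroupoid_isomorphic (graph_groupoid E) (graph_groupoid F) ->
  exists f : lpa E R -> lpa F R,
    ring_star_iso conj f /\ f @` lpa_diag E R = lpa_diag F R.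
Proof.
move=> rfE nsE rfF nsF [phi [psi [phiK psiK /groupoid_hom_mul phiM
  /groupoid_hom_mul psiM [/continuous_cylinder phiC /continuous_cylinder psiC]]]].
have /choice[f fP] := @transport_in_image E F R rfE rfF phi psi psiK phiC psiC.
have /choice[g gP] := @transport_in_image F E R rfF rfE psi phi phiK psiC phiC.
have injF := @rho_inj F R rfF nsF; have injE := @rho_inj E R rfE nsE.
have fK : cancel f g by move=> a; apply: injE => h; rewrite gP /= fP /= phiK.
have gK : cancel g f by move=> b; apply: injF => h; rewrite fP /= gP /= psiK.
have unitF := unit_transport psiK phiM psiM.
have unitE := unit_transport phiK psiM phiM.
exists f; split; first split.
- by exists g.
- by move=> a b; apply: injF => h; rewrite rhoD !fP /= rhoD.
- move=> a b; apply: injF => h; rewrite fP /= !rhoM !fP.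
  by rewrite (conv_transport phiK psiK phiM psiM).
- move=> a; apply: injF => h; rewrite fP /= !rho_star fP /=.
  by rewrite (inv_transport psiK phiM psiM).
apply/seteqP; split=> [_ [a /(lpa_diagP rfE nsE) da <-]|b /(lpa_diagP rfF nsF) db].
  by apply/(lpa_diagP rfF nsF) => h; rewrite fP => /da/unitF.
exists (g b); last exact: gK.
by apply/(lpa_diagP rfE nsE) => h; rewrite gP => /db/unitE.
Qed.

(** * Normalizers of the diagonal *)

Section Prefixes.
Variable E : digraph.
Implicit Types x y : ipath E.

Lemma prefix_le x y n m : (n <= m)%N -> ipath_prefix x m = ipath_prefix y m ->
  ipath_prefix x n = ipath_prefix y n.
Proof.
move=> nm e; apply: eq_prefix; first exact (congr1 (@prng E) e).
by move=> i hi; apply: prefix_eq e; apply: leq_trans nm.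
Qed.

Lemma prefix_inj x y : (forall n, ipath_prefix x n = ipath_prefix y n) -> x = y.
Proof. by move=> h; apply: ipath_ext => i; apply: (@prefix_eq E x y i.+1). Qed.

Lemma prefix_isolate (A : set (graph_arrow E)) x : finite_set A ->
  exists n, forall g, A g ->
    ipath_prefix (arr_src g) n = ipath_prefix x n -> arr_src g = x.
Proof.
move=> /finite_seqP[s ->]; elim: s => [|g s [n IH]]; first by exists 0%N.
have [m hm] : exists m, ipath_prefix (arr_src g) m = ipath_prefix x m -> arr_src g = x.
  have [->|ne] := pselect (arr_src g = x); first by exists 0%N.
  apply: contrapT => no; apply/ne/prefix_inj => m; apply: contrapT => nm.
  by apply: no; exists m => /nm.
exists (maxn n m) => h; rewrite /= inE => /orP[/eqP->|hs] e.
  by apply: hm; apply: prefix_le e; rewrite leq_maxr.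
by apply: IH => //; apply: prefix_le e; rewrite leq_maxl.
Qed.

End Prefixes.

Lemma finite_set_max (T : choiceType) (A : set T) (f : T -> int) :
  finite_set A -> A !=set0 -> exists2 m, A m & forall a, A a -> (f a <= f m)%R.
Proof.
move=> /finite_seqP[s ->] [a0]; elim: s a0 => [//|a s IH] a0 _.
case: s IH => [_|b s IH].
  exists a; first by rewrite /= inE eqxx.
  by move=> c; rewrite /= inE => /eqP->; lia.
have [|m ms hm] := IH b; first by rewrite /= inE eqxx.
have [le|lt] : (f a <= f m)%R \/ (f m <= f a)%R by lia.
  exists m; first by rewrite /= inE ms orbT.
  by move=> c; rewrite /= inE => /orP[/eqP->//|/hm].
exists a; first by rewrite /= inE eqxx.
by move=> c; rewrite /= inE => /orP[/eqP->|/hm]; lia.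
Qed.

Section Normalizers.
Variables (E : digraph) (R : idomainType) (conj : {rmorphism R -> R}).
Hypotheses (conjK : involutive conj) (rfE : row_finite E) (nsE : no_sources E).
Local Notation L := (lpa E R).
Local Notation "x ** y" := (lpa_mul x y) (at level 40, left associativity).
Local Notation D := (lpa_diag E R).
Local Notation star := (lpa_star conj).
Implicit Types (a b d n m : L) (x y z : ipath E) (mu nu : fpath E)
  (g h k : graph_arrow E).

Lemma conj_neq0 (c : R) : (conj c != 0) = (c != 0).
Proof. by rewrite -{1}(rmorph0 conj) (inj_eq (can_inj conjK)). Qed.

Lemma rho_diag_mulr a d g : D d ->
  rho (a ** d) g = rho a g * rho d (arr_unit (arr_src g)).
Proof.
move=> /(lpa_diagP rfE nsE) hd; rewrite rhoM; apply: conv_single.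
  exact/mulrel_unitr.
by move=> h k m _ /hd uk; have /(mulrel_unitr _ _ uk)[] := m.
Qed.

Lemma diagM d d' : D d -> D d' -> D (d ** d').
Proof.
move=> /(lpa_diagP rfE nsE) Dd Dd'; apply/(lpa_diagP rfE nsE) => g.
by rewrite rho_diag_mulr // mulf_eq0 negb_or => /andP[/Dd].
Qed.

Lemma diag_inj d d' : D d -> D d' ->
  (forall x, rho d (arr_unit x) = rho d' (arr_unit x)) -> d = d'.
Proof.
move=> /(lpa_diagP rfE nsE) Dd /(lpa_diagP rfE nsE) Dd' h; apply: (rho_inj rfE nsE) => g.
have [dg|/Dd/is_unitP[x ->]//] := eqVneq (rho d g) 0.
by have [->|/Dd'/is_unitP[x ->]//] := eqVneq (rho d' g) 0.
Qed.

Lemma diag0 : D 0.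
Proof. by apply/(lpa_diagP rfE nsE) => g; rewrite rho0 eqxx. Qed.

Lemma diag_mono mu : D (mono R mu mu).
Proof.
apply/(lpa_diagP rfE nsE) => g /(rho_monoP erefl); exact: cylinder_diag_unit.
Qed.

Definition proj x i : L := mono R (ipath_prefix x i) (ipath_prefix x i).

Lemma rho_proj x i y : rho (proj x i) (arr_unit y) =
  (`[< ipath_prefix y i = ipath_prefix x i >])%:R.
Proof.
rewrite rho_mono //; congr (nat_of_bool _)%:R; apply: asbool_equiv_eq.
by rewrite cylinder_unit plen_prefix; split.
Qed.

Lemma rho_proj_self x i : rho (proj x i) (arr_unit x) = 1.
Proof. by rewrite rho_proj; case: asboolP. Qed.

Lemma rho_local_unit d x : exists i, forall y,
  ipath_prefix y i = ipath_prefix x i -> rho d (arr_unit y) = rho d (arr_unit x).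
Proof.
have [mu [nu [c hc]]] := rho_locally_constant d (arr_unit x).
exists (maxn (plen mu) (plen nu)) => y e; apply: hc.
have /cylinderE[/= e1 e2 [el hl]] := c.
apply/cylinderE; split=> /=.
- by rewrite (prefix_le (leq_maxl _ _) e).
- by rewrite (prefix_le (leq_maxr _ _) e).
by split=> // i; have -> : plen mu = plen nu by lia.
Qed.

Definition normalizer n : Prop :=
  forall d, D d -> D (n ** d ** star n) /\ D (star n ** d ** n).

Lemma normalizer_star n : normalizer n -> normalizer (star n).
Proof. by move=> h d /h[h1 h2]; rewrite lpa_starK. Qed.

Lemma rho_starE a g : rho (star a) (arr_inv g) = conj (rho a g).
Proof. by rewrite rho_star arr_invK. Qed.

Lemma rho_col_finite a x : finite_set [set h | arr_src h = x /\ rho a h != 0].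
Proof.
apply: (sub_finite_set (B := @arr_inv E @` [set h | arr_rng h = x /\ rho (star a) h != 0])).
  move=> h [eh nh]; exists (arr_inv h); last exact: arr_invK.
  by split=> //; rewrite rho_starE conj_neq0.
by apply: finite_image; apply: rho_row_finite.
Qed.

(** The product [n d n^*], with [d] a small projection at the common source of
    [h1] and [h0], has value [n(h1) * conj n(h0)] at [h1 h0^-1] when no other
    pair contributes to the convolution.  This is so when [h1] has the largest
    degree over its range and [h0] the smallest; as [n d n^*] is diagonal and
    the coefficients form a domain, [h1 h0^-1] is then a unit. *)
Lemma normalizer_extremal n h1 h0 : normalizer n ->
  rho n h1 != 0 -> rho n h0 != 0 -> arr_src h1 = arr_src h0 ->
  (forall h, arr_src h = arr_src h1 -> rho n h != 0 -> arr_rng h = arr_rng h1 ->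
    (arr_deg h <= arr_deg h1)%R) ->
  (forall h, arr_src h = arr_src h0 -> rho n h != 0 -> arr_rng h = arr_rng h0 ->
    (arr_deg h0 <= arr_deg h)%R) -> h1 = h0.
Proof.
move=> Nn n1 n0 es top bot.
have [i hi] := prefix_isolate (arr_src h1) (rho_row_finite n (arr_rng h1)).
pose d := proj (arr_src h1) i; have Dd : D d by apply: diag_mono.
have [g mg] : exists g, mulrel h1 (arr_inv h0) g.
  by exists (arr_mul (es : arr_src h1 = arr_rng (arr_inv h0))); apply/mulrelP; eexists.
have [/(lpa_diagP rfE nsE)/(_ g) ug _] := Nn d Dd.
suff /ug/is_unitP[x eg] : rho (n ** d ** star n) g != 0.
  by move: mg; rewrite eg => /mulrel_inv[->]; rewrite arr_invK.
rewrite rhoM (conv_single mg) => [|h' k' m'].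
  rewrite rho_starE rho_diag_mulr // rho_proj_self mulr1.
  by rewrite mulf_neq0 // conj_neq0.
rewrite rho_diag_mulr // rho_proj mulf_eq0 negb_or => /andP[nh].
case: asboolP => [pre _ nk|]; last by rewrite eqxx.
have [e1 e2 e3 e4] := m'; have [f1 f2 f3 f4] := mg.
have rh : arr_rng h' = arr_rng h1 by rewrite -f2.
have sh : arr_src h' = arr_src h1 by apply: hi.
have nk' : rho n (arr_inv k') != 0 by rewrite -conj_neq0 -rho_star.
have sk : arr_src (arr_inv k') = arr_src h0 by rewrite /= -e1 sh.
have rk : arr_rng (arr_inv k') = arr_rng h0 by rewrite /= -e3 f3.
have d1 := top _ sh nh rh; have := bot _ sk nk' rk; move: f4 => /= f4 d0.
by apply: graph_arrow_ext => //; lia.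
Qed.

(** Over each range the arrow of largest and that of smallest degree agree, and
    the largest over one range agrees with the smallest over any other; so the
    source determines the arrow. *)
Lemma normalizer_src_inj n g h : normalizer n ->
  rho n g != 0 -> rho n h != 0 -> arr_src g = arr_src h -> g = h.
Proof.
move=> Nn ng nh es.
pose A k := [set k' | [/\ arr_src k' = arr_src k, rho n k' != 0 & arr_rng k' = arr_rng k]].
have fA k : finite_set (A k).
  by apply: sub_finite_set (rho_col_finite n (arr_src k)) => k' [].
have Ak k : rho n k != 0 -> A k !=set0 by move=> nk; exists k.
have ext k : rho n k != 0 -> exists t b : graph_arrow E, [/\ A k t, A k b,
    forall c, A k c -> (arr_deg c <= arr_deg t)%R &
    forall c, A k c -> (arr_deg b <= arr_deg c)%R].
  move=> nk; have [t At ht] := finite_set_max (@arr_deg E) (fA k) (Ak k nk).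
  have [b Ab hb] := finite_set_max (fun c => - arr_deg c) (fA k) (Ak k nk).
  by exists t, b; split=> // c /hb; lia.
have cross k k' (t b : graph_arrow E) : A k t -> A k' b -> arr_src k = arr_src k' ->
    (forall c, A k c -> (arr_deg c <= arr_deg t)%R) ->
    (forall c, A k' c -> (arr_deg b <= arr_deg c)%R) -> t = b.
  move=> [t1 t2 t3] [b1 b2 b3] e ht hb; apply: (normalizer_extremal Nn) => //.
  - by rewrite t1 b1.
  - by move=> c c1 c2 c3; apply: ht; rewrite /A /= c1 c3.
  - by move=> c c1 c2 c3; apply: hb; rewrite /A /= c1 c3.
have self k (t b : graph_arrow E) : rho n k != 0 -> A k t -> A k b ->
    (forall c, A k c -> (arr_deg c <= arr_deg t)%R) ->
    (forall c, A k c -> (arr_deg b <= arr_deg c)%R) -> k = t /\ k = b.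
  move=> nk At Ab ht hb; have etb := cross _ _ _ _ At Ab erefl ht hb.
  have Akk : A k k by [].
  have := ht _ Akk; have := hb _ Akk; rewrite -etb => d1 d2.
  have [t1 t2 t3] := At; suff -> : k = t by [].
  by apply: graph_arrow_ext => //; lia.
have [t [b [At Ab ht hb]]] := ext g ng; have [t' [b' [At' Ab' ht' hb']]] := ext h nh.
have [eg _] := self _ _ _ ng At Ab ht hb; have [_ eh] := self _ _ _ nh At' Ab' ht' hb'.
by rewrite eg eh; apply: (cross g h).
Qed.

Lemma normalizer_rng_inj n g h : normalizer n ->
  rho n g != 0 -> rho n h != 0 -> arr_rng g = arr_rng h -> g = h.
Proof.
move=> /normalizer_star Nn ng nh e; rewrite -(arr_invK g) -(arr_invK h).
congr arr_inv; apply: (normalizer_src_inj Nn) => //.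
  by rewrite rho_starE conj_neq0.
by rewrite rho_starE conj_neq0.
Qed.

Lemma normalizer_mono mu nu : psrc mu = psrc nu -> normalizer (mono R mu nu).
Proof.
move=> e.
have half (m n : fpath E) : psrc m = psrc n -> star (mono R m n) = mono R n m ->
    forall d, D d -> D (mono R m n ** d ** star (mono R m n)).
  move=> emn es d Dd; apply/(lpa_diagP rfE nsE) => g; rewrite rhoM.
  move=> /conv_neq0[h [k [m' + +]]].
  rewrite rho_diag_mulr // mulf_eq0 negb_or => /andP[+ _].
  rewrite es => /(rho_monoP emn) ch /(rho_monoP (esym emn)) ck.
  have ek : h = arr_inv k.
    have /cylinder_inv ck' : cylinder n m (arr_inv (arr_inv k)) by rewrite arr_invK.
    by apply: (cylinder_bisection_src ch ck'); case: m'.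
  by move: m' => []; rewrite ek => /= _ e1 e2 e3; split; [rewrite e1 e2 | lia].
have st (m n : fpath E) : star (mono R m n) = mono R n m.
  by have := lpa_star_monomial conj 1 m n; rewrite rmorph1 !scale1r.
move=> d Dd; split; first exact: half.
by have := half nu mu (esym e) (st _ _) d Dd; rewrite !st.
Qed.

Lemma normalizerM n m : normalizer n -> normalizer m -> normalizer (n ** m).
Proof.
have mA := alg_mulA (lpa_algebra E R); move=> Nn Nm d Dd; rewrite lpa_starM; split.
  have [/Nn[+ _] _] := Nm d Dd; by rewrite !mA.
by have [_ /Nm[_ +]] := Nn d Dd; rewrite !mA.
Qed.

(** As the support of [n] is a bisection, only [g] contributes at its source. *)
Lemma rho_conj_diag n d g : normalizer n -> D d -> rho n g != 0 ->
  rho (star n ** d ** n) (arr_unit (arr_src g)) =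
  conj (rho n g) * rho d (arr_unit (arr_rng g)) * rho n g.
Proof.
move=> Nn Dd ng; rewrite rhoM (@conv_single _ _ _ _ _ (arr_inv g) g).
- by rewrite rho_diag_mulr // rho_starE.
- exact/mulrel_inv.
move=> h k /mulrel_inv[-> sk] _ nk.
by rewrite (normalizer_src_inj Nn nk ng sk).
Qed.

End Normalizers.

(** * From diagonal-preserving isomorphisms to groupoid isomorphisms *)

Section Compactness.
Variables (F : digraph) (R : idomainType).
Hypotheses (rfF : row_finite F) (nsF : no_sources F).
Local Notation D := (lpa_diag F R).

Lemma rho_vertex_support (a : lpa F R) : exists V : seq (vert F),
  forall g, rho a g != 0 -> irng (arr_rng g) \in V.
Proof.
elim/lpa_ind: a => [|a b [V hV] [W hW]|c a [V hV]|mu nu e].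
- by exists [::] => g; rewrite rho0 eqxx.
- exists (V ++ W) => g; rewrite rhoD mem_cat.
  have [->|/hV -> //] := eqVneq (rho a g) 0.
  by rewrite add0r => /hW ->; rewrite orbT.
- exists V => g; rewrite rhoZ => n; apply: hV.
  by apply: contra_neq n => ->; rewrite mulr0.
- exists [:: prng mu] => g /(rho_monoP e)[z [/is_catP[-> _] _ _]].
  by rewrite inE; apply/eqP.
Qed.

Lemma uniform_seq (T : eqType) (P : T -> nat -> Prop) (s : seq T) :
  (forall t n m, (n <= m)%N -> P t n -> P t m) ->
  (forall t, t \in s -> exists n, P t n) -> exists n, forall t, t \in s -> P t n.
Proof.
move=> mon; elim: s => [|t s IH] h; first by exists 0%N.
have [|n hn] := IH; first by move=> t' ts; apply: h; rewrite inE ts orbT.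
have [m hm] := h t (mem_head _ _); exists (maxn n m) => t'.
rewrite inE => /orP[/eqP->|/hn]; first exact: mon (leq_maxr _ _) hm.
exact: mon (leq_maxl _ _).
Qed.

(** Compactness of the unit space over finitely many vertices, for decreasing
    sequences of supports. *)
Lemma diag_compact (d : nat -> lpa F R) : (forall n, D (d n)) ->
  (forall n, d n <> 0) ->
  (forall n y, rho (d n.+1) (arr_unit y) != 0 -> rho (d n) (arr_unit y) != 0) ->
  exists y, forall n, rho (d n) (arr_unit y) != 0.
Proof.
move=> Dd nz dec; apply: contrapT => no.
have decle n m y : (n <= m)%N -> rho (d n) (arr_unit y) = 0 -> rho (d m) (arr_unit y) = 0.
  move=> /subnKC <-; elim: (m - n)%N => [|k IH]; first by rewrite addn0.
  by move=> /IH /eqP; rewrite addnS => h; apply: contrapT => /eqP/dec; rewrite h.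
pose P (mu nu : fpath F) (n : nat) :=
  forall y, cylinder mu nu (arr_unit y) -> rho (d n) (arr_unit y) = 0.
have Pmon mu nu n m : (n <= m)%N -> P mu nu n -> P mu nu m.
  by move=> nm h y /h; apply: decle.
(* If every unit had some d n vanishing there, then by bar induction a single
   d n would vanish on all units of each cylinder Z(v). *)
have vert0 (v : vert F) : exists n, P (@FPath F v [::] isT) (@FPath F v [::] isT) n.
  apply: (@cylinder_bar F (fun mu nu => exists n, P mu nu n)) => //.
    move=> mu nu e hP; have [r [ur hr]] := row_enum rfF (psrc mu).
    have [||n hn] := @uniform_seq _ (fun f => P (pext mu [:: f]) (pext nu [:: f])) r.
    - by move=> f n m; apply: Pmon.
    - by move=> f; rewrite hr => /eqP; apply: hP.
    exists n => y [z [a b c]]; apply: (hn (z 0%N)); first by rewrite hr; apply/eqP; case: a.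
    apply/cylinder_pext => //=; last by exists z.
    by rewrite andbT; apply/eqP; case: a.
  move=> g /cylinder_diag_unit/is_unitP[y ->].
  have [n hn] : exists n, rho (d n) (arr_unit y) = 0.
    apply: contrapT => h; apply: no; exists y => n.
    by apply/eqP => e; apply: h; exists n.
  have [mu [nu [c hc]]] := rho_locally_constant (d n) (arr_unit y).
  by exists mu, nu; split=> // m' n' sub; exists n => y' /sub/hc ->.
have [V hV] := rho_vertex_support (d 0%N).
have [||n hn] := @uniform_seq _ (fun v => P (@FPath F v [::] isT) (@FPath F v [::] isT)) V.
- by move=> v n m; apply: Pmon.
- by move=> v _; apply: vert0.
apply: (nz n); apply: (diag_inj rfF nsF) => // [|y]; first exact: diag0.
rewrite rho0.
have [v0|/hV vV] := eqVneq (rho (d 0%N) (arr_unit y)) 0; first exact: decle v0.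
apply: (hn _ vV); apply/cylinder_unit; exact: fpath_ext.
Qed.

End Compactness.

Record diag_iso (E F : digraph) (R : idomainType) (conj : {rmorphism R -> R})
    (f : lpa E R -> lpa F R) (f' : lpa F R -> lpa E R) : Prop := DiagIso {
  diK : cancel f f';
  diK' : cancel f' f;
  diM : forall a b, f (lpa_mul a b) = lpa_mul (f a) (f b);
  di0 : f 0 = 0;
  di_star : forall a, f (lpa_star conj a) = lpa_star conj (f a);
  di_diag : forall a, lpa_diag E R a <-> lpa_diag F R (f a) }.

Lemma diag_iso_sym (E F : digraph) (R : idomainType) (conj : {rmorphism R -> R})
    (f : lpa E R -> lpa F R) f' : diag_iso conj f f' -> diag_iso conj f' f.
Proof.
move=> [fK fK' fM f0 fs fD]; split=> //.
- by move=> a b; rewrite -{1}(fK' a) -{1}(fK' b) -fM fK.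
- by rewrite -f0 fK.
- by move=> a; rewrite -{1}(fK' a) -fs fK.
- by move=> a; rewrite fD fK'.
Qed.

(** Points of the spectra of the two diagonals are compared through the ideals of
    the elements that vanish there. *)
Definition unit_rel (E F : digraph) (R : idomainType) (f : lpa E R -> lpa F R) x y :=
  forall d, lpa_diag E R d ->
    (rho d (arr_unit x) != 0 <-> rho (f d) (arr_unit y) != 0).

Lemma unit_rel_inj (E F : digraph) (R : idomainType) (f : lpa E R -> lpa F R) x x' y :
  row_finite E -> no_sources E -> unit_rel f x y -> unit_rel f x' y -> x = x'.
Proof.
move=> rfE nsE h h'; apply: prefix_inj => n; symmetry.
have Dp : lpa_diag E R (proj R x n) by apply: diag_mono.
have [+ _] := h _ Dp; rewrite rho_proj_self oner_eq0 => /(_ isT).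
by move=> /(h' _ Dp); rewrite rho_proj; case: asboolP; rewrite ?eqxx.
Qed.

Section Reconstruction.
Variables (E F : digraph) (R : idomainType) (conj : {rmorphism R -> R}).
Hypotheses (conjK : involutive conj).
Hypotheses (rfE : row_finite E) (nsE : no_sources E).
Hypotheses (rfF : row_finite F) (nsF : no_sources F).
Local Notation "x ** y" := (lpa_mul x y) (at level 40, left associativity).
Variables (f : lpa E R -> lpa F R) (f' : lpa F R -> lpa E R).
Hypothesis fI : diag_iso conj f f'.
Let fM := diM fI.
Let fI' := diag_iso_sym fI.

Lemma unit_rel_sym x y : unit_rel f x y -> unit_rel f' y x.
Proof.
move=> h d Dd; rewrite -{1}(diK' fI d); symmetry; apply: h.
by apply/(di_diag fI); rewrite (diK' fI).
Qed.

Lemma normalizer_image n : normalizer conj n -> normalizer conj (f n).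
Proof.
move=> Nn d Dd; have Dd' : lpa_diag E R (f' d).
  by apply/(di_diag fI); rewrite (diK' fI).
have [/(di_diag fI) + /(di_diag fI)] := Nn _ Dd'.
by rewrite !fM !(di_star fI) (diK' fI).
Qed.

(** The images of the projections on the initial segments of [x] have decreasing
    nonempty compact supports; the point sought lies in all of them. *)
Lemma unit_rel_total x : exists y, unit_rel f x y.
Proof.
pose e n := proj R x n; have De n : lpa_diag E R (e n) by apply: diag_mono.
have Dfe n : lpa_diag F R (f (e n)) by apply/(di_diag fI).
have edec n : e n.+1 ** e n = e n.+1.
  apply: (diag_inj rfE nsE) => // [|y]; first exact: diagM.
  rewrite rho_diag_mulr // !rho_proj; case: asboolP => [h|_]; last by rewrite mul0r.
  by case: asboolP; rewrite ?mulr1 // => -[]; apply: (prefix_le (leqnSn n)).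
have [n|n y|y hy] := diag_compact rfF nsF Dfe.
- move=> /(congr1 f'); rewrite (diK fI) (di0 fI').
  move=> /(congr1 (fun a => rho a (arr_unit x))); rewrite rho_proj_self rho0.
  by apply/eqP; rewrite oner_eq0.
- by rewrite -edec fM rho_diag_mulr // mulf_eq0 negb_or => /andP[_].
exists y => d Dd; have Dfd : lpa_diag F R (f d) by apply/(di_diag fI).
have [n hn] := rho_local_unit d x.
have [d0|dn0] := eqVneq (rho d (arr_unit x)) 0.
  have : d ** e n = 0.
    apply: (diag_inj rfE nsE) => [||z]; [exact: diagM|exact: diag0|].
    rewrite rho_diag_mulr // rho_proj rho0.
    by case: asboolP => [/hn ->|_]; rewrite ?d0 ?mul0r ?mulr0.
  move=> /(congr1 f); rewrite fM (di0 fI) => /(congr1 (fun a => rho a (arr_unit y))).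
  rewrite rho_diag_mulr // rho0 => /eqP; rewrite mulf_eq0 (negbTE (hy n)) orbF.
  by move=> ->.
split=> // _; apply/eqP => fd0; have [m hm] := rho_local_unit (f d) y.
(* If f d vanished at y, its product with a small projection q at y would be
   zero.  Pulled back, d kills f' q, and hence so does e n, because d is a nonzero
   constant on the support of e n.  But f (e n) and q are both nonzero at y. *)
pose q := proj R y m; have Dq : lpa_diag F R q by apply: diag_mono.
have Dfq : lpa_diag E R (f' q) by apply/(di_diag fI').
have fdq : f d ** q = 0.
  apply: (diag_inj rfF nsF) => [||z]; [exact: diagM|exact: diag0|].
  rewrite rho_diag_mulr // rho_proj rho0.
  by case: asboolP => [/hm ->|_]; rewrite ?fd0 ?mul0r ?mulr0.
have dfq : d ** f' q = 0.
  by rewrite -(diK fI (d ** f' q)) fM (diK' fI) fdq (di0 fI').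
have efq : e n ** f' q = 0.
  apply: (diag_inj rfE nsE) => [||z]; [exact: diagM|exact: diag0|].
  rewrite rho_diag_mulr // rho_proj rho0.
  case: asboolP => [/hn dz|_]; last by rewrite mul0r.
  have := congr1 (fun a => rho a (arr_unit z)) dfq.
  rewrite rho_diag_mulr // rho0 dz => /eqP; rewrite mulf_eq0 (negbTE dn0) /=.
  by rewrite mul1r => /eqP.
have := congr1 (fun a => rho (f a) (arr_unit y)) efq.
rewrite fM (diK' fI) (di0 fI) rho_diag_mulr // rho_proj_self mulr1 rho0.
by apply/eqP; apply: hy.
Qed.

(** As [n] is nonzero at [g], the element [n^* d n] vanishes at the source of [g]
    exactly when [d] vanishes at its range; comparing with its image yields both
    the arrow [h] and the correspondence of the ranges. *)
Lemma arrow_image n g y : normalizer conj n -> rho n g != 0 ->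
  unit_rel f (arr_src g) y ->
  exists h, [/\ arr_src h = y, rho (f n) h != 0 & unit_rel f (arr_rng g) (arr_rng h)].
Proof.
move=> Nn ng Ky; have Nfn := normalizer_image Nn.
have val d : lpa_diag E R d ->
    (rho d (arr_unit (arr_rng g)) != 0 <->
     rho (lpa_star conj (f n) ** f d ** f n) (arr_unit y) != 0).
  move=> Dd; have [_ /Ky] := Nn d Dd; rewrite !fM (di_star fI) => <-.
  rewrite (rho_conj_diag conjK) // !mulf_eq0 !negb_or conj_neq0 // ng andbT /=.
  by split.
pose d0 := proj R (arr_rng g) 0; have Dd0 : lpa_diag E R d0 by apply: diag_mono.
have /(val _ Dd0) : rho d0 (arr_unit (arr_rng g)) != 0 by rewrite rho_proj_self oner_eq0.
rewrite rhoM => /conv_neq0[h' [h [/mulrel_inv[_ sh] _ nh]]].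
exists h; split=> // d Dd; rewrite (val d Dd) -sh.
have Dfd : lpa_diag F R (f d) by apply/(di_diag fI).
by rewrite (rho_conj_diag conjK) // !mulf_eq0 !negb_or conj_neq0 // nh andbT.
Qed.

(** If [n] and [m] are nonzero at [g] then [n^* m], cut down near the source of
    [g], is diagonal and nonzero there; hence so is its image, which forces
    [f n] and [f m] to be nonzero at the same arrow. *)
Lemma arrow_image_indep n m g h : normalizer conj n -> normalizer conj m ->
  rho n g != 0 -> rho m g != 0 -> rho (f n) h != 0 ->
  unit_rel f (arr_src g) (arr_src h) -> rho (f m) h != 0.
Proof.
move=> Nn Nm ng mg nh Kgh; have Nfn := normalizer_image Nn.
have [al1 [be1 [c1 hc1]]] := rho_locally_constant n g.
have [al2 [be2 [c2 hc2]]] := rho_locally_constant m g.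
have [al [be [c sub]]] := cylinder_join c1 c2.
have ab := cylinder_psrc c.
pose d := mono R be be; have Dd : lpa_diag E R d by apply: diag_mono.
pose a := lpa_star conj n ** m ** d.
have Da : lpa_diag E R a.
  apply/(lpa_diagP rfE nsE) => k; rewrite rho_diag_mulr // mulf_eq0 negb_or.
  rewrite rhoM => /andP[/conv_neq0[h' [k' [m' nh' mk']]]].
  move=> /(rho_monoP erefl)[z [/= cz _ _]].
  have [t [/sub[/hc1 nt /hc2 mt] st]] := cylinder_over_src ab cz.
  have ekt : k' = t.
    apply: (normalizer_src_inj conjK rfE nsE Nm) => //; first by rewrite mt.
    by rewrite st; case: m'.
  have nk' : rho n k' != 0 by rewrite ekt nt.
  have nhi : rho n (arr_inv h') != 0 by rewrite -(conj_neq0 conjK) -rho_star.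
  have e : arr_inv h' = k'.
    apply: (normalizer_rng_inj conjK rfE nsE Nn) => //; by case: m'.
  have eh : h' = arr_inv k' by rewrite -e arr_invK.
  by move: m'; rewrite eh => -[/= _ e1 e2 e3]; split; [rewrite e1 e2 | lia].
have na : rho a (arr_unit (arr_src g)) != 0.
  rewrite rho_diag_mulr // mulf_neq0 //; last first.
    by apply/(rho_monoP erefl)/cylinder_unit; have /cylinderE[] := c.
  rewrite rhoM (@conv_single _ _ _ _ _ (arr_inv g) g).
  - by rewrite rho_starE mulf_neq0 // conj_neq0.
  - exact/mulrel_inv.
  move=> h' k' /mulrel_inv[-> sk] _ mk.
  by rewrite (normalizer_src_inj conjK rfE nsE Nm mk mg sk).
have /(Kgh _ Da) := na; rewrite (fM (_ ** m)) (fM _ m) (di_star fI).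
rewrite rho_diag_mulr //; last exact/(di_diag fI).
rewrite mulf_eq0 negb_or rhoM => /andP[/conv_neq0[h' [k' [/mulrel_inv[eh sk] nh' mk']]] _].
rewrite eh rho_starE (conj_neq0 conjK) in nh'.
by rewrite (normalizer_src_inj conjK rfF nsF Nfn nh nh') // sk.
Qed.

Definition arrow_rel g h : Prop := unit_rel f (arr_src g) (arr_src h) /\
  exists n, [/\ normalizer conj n, rho n g != 0 & rho (f n) h != 0].

Lemma arrow_rel_mem g h m : arrow_rel g h -> normalizer conj m -> rho m g != 0 ->
  rho (f m) h != 0.
Proof.
by move=> [Kgh [n [Nn ng nh]]] Nm mg; apply: (arrow_image_indep Nn Nm ng).
Qed.

Lemma arrow_rel_total g : exists h, arrow_rel g h.
Proof.
have [mu [nu c]] := cylinder_nbhs g; have e := cylinder_psrc c.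
have Nn : normalizer conj (mono R mu nu) by apply: normalizer_mono.
have ng : rho (mono R mu nu) g != 0 by apply/rho_monoP.
have [y Ky] := unit_rel_total (arr_src g).
have [h [sh nh _]] := arrow_image Nn ng Ky.
by exists h; split; [rewrite sh | exists (mono R mu nu)].
Qed.

Lemma unit_rel_fun x y y' : unit_rel f x y -> unit_rel f x y' -> y = y'.
Proof. by move=> /unit_rel_sym h /unit_rel_sym; apply: unit_rel_inj h. Qed.

Lemma arrow_rel_fun g h h' : arrow_rel g h -> arrow_rel g h' -> h = h'.
Proof.
move=> gh gh'; have [K [n [Nn ng nh]]] := gh; have [K' _] := gh'.
have nh' := arrow_rel_mem gh' Nn ng.
apply: (normalizer_src_inj conjK rfF nsF (normalizer_image Nn)) => //.
exact: unit_rel_fun K K'.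
Qed.

Lemma arrow_rel_rng g h : arrow_rel g h -> unit_rel f (arr_rng g) (arr_rng h).
Proof.
move=> [K [n [Nn ng nh]]]; have [h' [sh nh' Kr]] := arrow_image Nn ng K.
by rewrite (normalizer_src_inj conjK rfF nsF (normalizer_image Nn) nh nh').
Qed.

(** The witness for the product is the product of the normalizers. *)
Lemma arrow_rel_mul g1 g2 g h1 h2 : arrow_rel g1 h1 -> arrow_rel g2 h2 ->
  mulrel g1 g2 g -> exists2 h, mulrel h1 h2 h & arrow_rel g h.
Proof.
move=> r1 r2 m; have [K1 [n1 [N1 ng1 nh1]]] := r1; have [K2 [n2 [N2 ng2 nh2]]] := r2.
have e : arr_src h1 = arr_rng h2.
  by apply: (unit_rel_fun K1); case: m => -> _ _ _; apply: arrow_rel_rng.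
exists (arr_mul e); first by apply/mulrelP; exists e.
have m' : mulrel h1 h2 (arr_mul e) by apply/mulrelP; exists e.
split; first by case: m => _ _ -> _.
have prod (G : digraph) (a b : lpa G R) k1 k2 k : row_finite G -> no_sources G ->
    normalizer conj a -> mulrel k1 k2 k -> rho a k1 != 0 -> rho b k2 != 0 ->
    rho (a ** b) k != 0.
  move=> rfG nsG Na mk ak bk; rewrite rhoM (conv_single mk) ?mulf_neq0 //.
  move=> h k' mh ah _; apply: (normalizer_rng_inj conjK rfG nsG Na) => //.
  by case: mh => _ <- _ _; case: mk.
exists (n1 ** n2); split; first exact: normalizerM.
  exact: prod ng1 ng2.
by rewrite fM; apply: prod nh1 nh2 => //; apply: normalizer_image.
Qed.

End Reconstruction.

Lemma arrow_rel_sym (E F : digraph) (R : idomainType) (conj : {rmorphism R -> R})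
    (f : lpa E R -> lpa F R) f' g h : diag_iso conj f f' ->
  arrow_rel conj f g h -> arrow_rel conj f' h g.
Proof.
move=> fI [K [n [Nn ng nh]]]; split; first exact: (unit_rel_sym fI).
exists (f n); rewrite (diK fI); split=> //.
exact: (normalizer_image fI).
Qed.

Section Continuity.
Variables (E F : digraph) (R : idomainType) (conj : {rmorphism R -> R}).
Hypotheses (conjK : involutive conj).
Hypotheses (rfE : row_finite E) (nsE : no_sources E).
Hypotheses (rfF : row_finite F) (nsF : no_sources F).

(** The preimage of the cylinder of [m] and [n] is the support of the element
    that [f] maps to [s_m s_n^*], and supports are open. *)
Lemma arrow_rel_continuous (f : lpa E R -> lpa F R) f' g h (m n : fpath F) :
  diag_iso conj f f' -> arrow_rel conj f g h -> cylinder m n h ->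
  exists mu nu, cylinder mu nu g /\
    forall g' h', cylinder mu nu g' -> arrow_rel conj f g' h' -> cylinder m n h'.
Proof.
move=> fI gh c; have e := cylinder_psrc c; have fI' := diag_iso_sym fI.
pose a := f' (mono R m n).
have Nm : normalizer conj (mono R m n) by apply: normalizer_mono.
have Na : normalizer conj a by apply: (normalizer_image fI').
have ag : rho a g != 0.
  apply: (arrow_rel_mem conjK rfF nsF rfE nsE fI' (arrow_rel_sym fI gh) Nm).
  exact/rho_monoP.
have [mu [nu [cg hc]]] := rho_locally_constant a g.
exists mu, nu; split=> // g' h' /hc eg gh'.
have := arrow_rel_mem conjK rfE nsE rfF nsF fI gh' Na.
by rewrite eg ag (diK' fI) => /(_ isT)/(rho_monoP e).
Qed.

Lemma mul_hom_of_arrow_rel (f : lpa E R -> lpa F R) f' phi :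
  diag_iso conj f f' -> (forall g, arrow_rel conj f g (phi g)) ->
  mul_hom phi /\ cylinder_continuous phi.
Proof.
move=> fI hphi; split.
  move=> g1 g2 g m.
  have [h mh gh] := arrow_rel_mul conjK rfE nsE rfF nsF fI (hphi g1) (hphi g2) m.
  by rewrite (arrow_rel_fun conjK rfE nsE rfF nsF fI (hphi g) gh).
move=> g m n c; have [mu [nu [cg hc]]] := arrow_rel_continuous fI (hphi g) c.
by exists mu, nu; split=> // k ck; apply: hc ck (hphi k).
Qed.

End Continuity.

Lemma groupoid_iso_of_diag_iso (E F : digraph) (R : idomainType)
    (conj : {rmorphism R -> R}) (f : lpa E R -> lpa F R) f' :
  involutive conj -> row_finite E -> no_sources E -> row_finite F -> no_sources F ->
  diag_iso conj f f' ->
  topGroupoid_isomorphic (graph_groupoid E) (graph_groupoid F).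
Proof.
move=> conjK rfE nsE rfF nsF fI.
have /choice[phi hphi] := arrow_rel_total conjK rfE nsE rfF nsF fI.
have fI' := diag_iso_sym fI.
have /choice[psi hpsi] := arrow_rel_total conjK rfF nsF rfE nsE fI'.
have [phiM phiC] := mul_hom_of_arrow_rel conjK rfE nsE rfF nsF fI hphi.
have [psiM psiC] := mul_hom_of_arrow_rel conjK rfF nsF rfE nsE fI' hpsi.
exists phi, psi; split.
- move=> g; apply: (arrow_rel_fun conjK rfF nsF rfE nsE fI' (hpsi (phi g))).
  exact: arrow_rel_sym (hphi g).
- move=> h; apply: (arrow_rel_fun conjK rfE nsE rfF nsF fI (hphi (psi h))).
  exact: arrow_rel_sym (hpsi h).
- exact/groupoid_hom_mul.
- exact/groupoid_hom_mul.
- by split; apply/continuous_cylinder.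
Qed.

(** * The equivalence *)

Theorem theorem6p2 (E F : digraph) (R : idomainType)
    (conj : {rmorphism R -> R}) (conjK : involutive conj)
    (E_row_finite : row_finite E) (E_no_sources : no_sources E)
    (F_row_finite : row_finite F) (F_no_sources : no_sources F) :
  (exists f : lpa E R -> lpa F R,
     ring_star_iso conj f /\ f @` lpa_diag E R = lpa_diag F R)
  <-> topGroupoid_isomorphic (graph_groupoid E) (graph_groupoid F).
Proof.
split=> [[f [[[f' fK fK'] fD fM fs] fdiag]]|]; last exact: iso_of_groupoid_iso.
apply: (@groupoid_iso_of_diag_iso E F R conj f f') => //; split=> //.
  by apply: (addrI (f 0)); rewrite -fD !addr0.
move=> a; split=> [Da|]; first by rewrite -fdiag; exists a.
by rewrite -fdiag => -[b Db /(can_inj fK) <-].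
Qed.
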